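(* Let $q\in\mathbb C^*$, let $m$ be a positive integer, and for $1\le i\le m$ let $\lambda_i\in\mathbb C^*$, $\alpha_i\in\mathbb C$, $\beta_i=(\beta_{1,i},\beta_{2,i})\in\mathbb C^2$, $\gamma_i=(\gamma_{1,i},\gamma_{2,i})\in\mathbb C^2$, $\mathbf h_i\in\mathcal T_{\alpha_i}$, where $\beta_i=0$ if $q\neq-1$ and $\gamma_i=0$ if $-2q\notin\mathbb N$. Let $V$ be a restricted $\mathcal B(q)$-module and put $T=\bigotimes_{i=1}^m\Omega(\lambda_i,\alpha_i,\beta_i,\gamma_i,\mathbf h_i)\otimes V$. Then the $\mathcal B(q)$-module $T$ is irreducible if and only if $\lambda_1,\dots,\lambda_m$ are pairwise distinct, $V$ is an irreducible (restricted) $\mathcal B(q)$-module, and for each $1\le i\le m$ either $\alpha_i\neq0$, or $q=-1$ and $\beta_{1,i}\ne0$.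
   Context: $\mathbb N=\{0,1,2,\dots\}$, $\mathbb C^*=\mathbb C\setminus\{0\}$. For $q\in\mathbb C^*$, the Takiff Block type Lie algebra $\mathcal B(q)$ is the complex Lie algebra with basis $\{L_{m,i},W_{m,i},C_1,C_2\mid (m,i)\in\mathbb Z\times\mathbb N\}$, with $C_1,C_2$ central and $[L_{m,i},L_{n,j}]=(n(i+q)-m(j+q))L_{m+n,i+j}+\frac{m^3-m}{12}\delta_{i+j,0}\delta_{m+n,0}C_1$, $[L_{m,i},W_{n,j}]=(n(i+q)-m(j+q))W_{m+n,i+j}+\frac{m^3-m}{12}\delta_{i+j,0}\delta_{m+n,0}C_2$, $[W_{m,i},W_{n,j}]=0$. A $\mathcal B(q)$-module $V$ is restricted if for every $v\in V$ there is $n\in\mathbb N$ such that $L_{m,i}v=W_{m,i}v=0$ for all $m>n$ and all $i\in\mathbb N$. For $k\in\mathbb N$, $n\in\mathbb Z$, $\alpha\in\mathbb C$ put $h_{n,k;\alpha}(t)=nt^k-n(n-1)\alpha\frac{t^k-\alpha^k}{t-\alpha}\in\mathbb C[t]$. $\mathcal T_\alpha$ is the set of all families $\mathbf h=\{h_m(t)\mid m\in\mathbb Z\}$ of polynomials of the form $h_m(t)=\sum_{i\ge0}\xi_ih_{m,i;\alpha}(t)$ with $\xi_i\in\mathbb C$ independent of $m$ and all but finitely many zero. For $\mathbf h\in\mathcal T_\alpha$ and $c\in\mathbb C$ put $\Theta_{\mathbf h,c}(t)=c\,\frac{h_1(-t)-h_1(\alpha)}{-t-\alpha}\in\mathbb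 C[t]$. For $\lambda\in\mathbb C^*$, $\alpha\in\mathbb C$, $\beta=(\beta_1,\beta_2)$, $\gamma=(\gamma_1,\gamma_2)$ in $\mathbb C^2$, $\mathbf h\in\mathcal T_\alpha$, the $\mathcal B(q)$-module $\Omega(\lambda,\alpha,\beta,\gamma,\mathbf h)$ is $\mathbb C[t,s]$ with $C_1,C_2$ acting by $0$ and, for $(m,i)\in\mathbb Z\times\mathbb N$, $L_{m,i}f(t,s)=\delta_{i,0}\lambda^m(s+qh_m(q^{-1}t))f(t,s-mq)-\delta_{i,0}m\lambda^mq(t-mq\alpha)\frac{\partial}{\partial t}f(t,s-mq)+\delta_{m,0}\delta_{i,-2q}\gamma_2f(t,s)+\delta_{i,1}\delta_{q,-1}\lambda^m\big(\beta_2+m\Theta_{\mathbf h,\beta_1}(t)+m\beta_1\frac{\partial}{\partial t}\big)f(t,s+m)$, $W_{m,i}f(t,s)=\delta_{i,0}\lambda^m(t-mq\alpha)f(t,s-mq)+\delta_{m,0}\delta_{i,-2q}\gamma_1f(t,s)+\delta_{i,1}\delta_{q,-1}\beta_1\lambda^mf(t,s+m)$. Tensor products carry the usual Lie algebra tensor product action. *)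

(* Defs.v *)
From HB Require Import structures.
From mathcomp Require Import all_boot all_order all_algebra.
From mathcomp Require Import generic_quotient ring_quotient finmap.
From mathcomp Require Import boolp.
From mathcomp Require Import monalg.

Set Implicit Arguments.
Unset Strict Implicit.
Unset Printing Implicit Defensive.

Import Order.TTheory GRing.Theory Num.Theory.

Local Open Scope ring_scope.
Local Open Scope quotient_scope.

(* {malg K[B]}, the finitely supported functions B -> K, is used throughout
   only as the vector space with basis B: the basis vectors are << b >>. *)

Section LinearExtension.
Context {K : fieldType} {B : choiceType} {X : lmodType K}.
Implicit Types (g : B -> X) (x y : {malg K[B]}).

Definition lext g x : X := \sum_(b <- msupp x) x@_b *: g b.

Lemma lextw g x (d : {fset B}) : fsubset (msupp x) d ->
  lext g x = \sum_(b <- d) x@_b *: g b.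
Proof.
move=> sxd; rewrite /lext; apply: big_fset_incl => // b _ bx.
by rewrite mcoeff_outdom // scale0r.
Qed.

Lemma lext_linear g : linear (lext g).
Proof.
move=> a x y; set d := fsetU (msupp (a *: x + y)) (fsetU (msupp x) (msupp y)).
rewrite (@lextw g x d); last first.
  by apply: fsubsetU; apply/orP; right; exact: fsubsetUl.
rewrite (@lextw g y d); last first.
  by apply: fsubsetU; apply/orP; right; exact: fsubsetUr.
rewrite (@lextw g (a *: x + y) d); last exact: fsubsetUl.
rewrite scaler_sumr -big_split /=; apply: eq_bigr => b _.
by rewrite mcoeffD mcoeffZ scalerDl scalerA.
Qed.

HB.instance Definition _ g :=
  GRing.isLinear.Build K {malg K[B]} X *:%R (lext g) (lext_linear g).

Lemma lextB g x y : lext g (x - y) = lext g x - lext g y.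
Proof. exact: linearB. Qed.

Lemma lext_basis g b : lext g << b >> = g b.
Proof. by rewrite /lext msuppU oner_eq0 big_seq_fset1 mcoeffUU scale1r. Qed.

Lemma lext_linearr (Y : lmodType K) (g : B -> Y -> X) x :
  (forall b, linear (g b)) -> linear (fun u : Y => lext (g^~ u) x).
Proof.
move=> gL a u v; rewrite /lext scaler_sumr -big_split /=.
by apply: eq_bigr => b _; rewrite gL scalerDr !scalerA [_ * a]mulrC.
Qed.

Lemma lext_uniq g (h : {malg K[B]} -> X) : linear h ->
  (forall b, h << b >> = g b) -> h =1 lext g.
Proof.
move=> hL hg x; pose hl := GRing.isLinear.Build K {malg K[B]} X *:%R h hL.
pose h' : {linear {malg K[B]} -> X} := HB.pack h hl.
rewrite -[h]/(h' : _ -> _) {1}[x]monalgE linear_sum; apply: eq_bigr => b _.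
have -> : << x@_b *g b >> = x@_b *: << b >> :> {malg K[B]}.
  by apply/malgP => c; rewrite mcoeffZ !mcoeffU mulr_natr.
by rewrite linearZ /= hg.
Qed.

End LinearExtension.

Section LieModules.
Context {K : fieldType} {g : lmodType K} (br : g -> g -> g).

Record lie_module (V : lmodType K) (act : g -> V -> V) : Prop := LieModule {
  lie_act_linearl : forall v, linear (act^~ v);
  lie_act_linearr : forall x, linear (act x);
  lie_act_bracket : forall x y v,
    act (br x y) v = act x (act y v) - act y (act x v)
}.

Record submodule (V : lmodType K) (act : g -> V -> V) (S : V -> Prop) : Prop :=
  Submodule {
  submodule0 : S 0;
  submoduleP : forall (a : K) (u v : V), S u -> S v -> S (a *: u + v);
  submodule_act : forall (x : g) (v : V), S v -> S (act x v)
}.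

Definition irreducible (V : lmodType K) (act : g -> V -> V) : Prop :=
  (exists v : V, v <> 0) /\
  forall S : V -> Prop, submodule act S ->
    (forall v, S v -> v = 0) \/ (forall v, S v).

End LieModules.

(* The tensor product U (x) ... (x) U (x) V with m factors U, constructed as
   the free vector space on {ffun 'I_m -> U} * V modulo multilinearity. *)

Section TensorProduct.
Context {K : fieldType} {m : nat} {U V : lmodType K}.
Implicit Types (f : {ffun 'I_m -> U}) (v w : V).

Definition upd f (i : 'I_m) (u : U) : {ffun 'I_m -> U} :=
  [ffun j => if j == i then u else f j].

Definition tensor_free := {malg K[({ffun 'I_m -> U} * V)%type]}.

Definition tfree f v : tensor_free := << (f, v) >>.

Inductive tensor_null : tensor_free -> Prop :=
| TNull0 : tensor_null 0
| TNullP (a : K) (x y : tensor_free) :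
    tensor_null x -> tensor_null y -> tensor_null (a *: x + y)
| TNullU f (i : 'I_m) (a : K) (u u' : U) v :
    tensor_null (tfree (upd f i (a *: u + u')) v
                 - (a *: tfree (upd f i u) v + tfree (upd f i u') v))
| TNullV f (a : K) v w :
    tensor_null (tfree f (a *: v + w) - (a *: tfree f v + tfree f w)).

Definition tensor_nullb : {pred tensor_free} := fun x => `[< tensor_null x >].

Lemma tensor_nullZ a x : tensor_null x -> tensor_null (a *: x).
Proof. by move=> nx; rewrite -[_ *: _]addr0; apply: TNullP => //; exact: TNull0. Qed.

Lemma tensor_null_zmod : zmod_closed tensor_nullb.
Proof.
split=> [|x y /asboolP nx /asboolP ny]; apply/asboolP; first exact: TNull0.
by rewrite addrC -scaleN1r; apply: TNullP.
Qed.

HB.instance Definition _ :=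
  GRing.isZmodClosed.Build tensor_free tensor_nullb tensor_null_zmod.

Definition tensor := Quotient.quot (tensor_nullb : zmodClosed tensor_free).

HB.instance Definition _ := GRing.Zmodule.on tensor.

Definition tensor_pi (x : tensor_free) : tensor := \pi_tensor x.

Lemma tensor_piP x y : tensor_pi x = tensor_pi y <-> tensor_null (x - y).
Proof.
by split=> [/eqP|n]; [|apply/eqP];
  rewrite /tensor_pi -Quotient.idealrBE; [move/asboolP | apply/asboolP].
Qed.

Lemma tensor_piD x y : tensor_pi (x + y) = tensor_pi x + tensor_pi y.
Proof. by rewrite /tensor_pi raddfD. Qed.

Lemma tensor_repr_pi x : tensor_null (repr (tensor_pi x) - x).
Proof. by apply/tensor_piP; rewrite /tensor_pi reprK. Qed.

Definition tensor_scale (a : K) (t : tensor) : tensor := tensor_pi (a *: repr t).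

Lemma tensor_scale_pi a x : tensor_scale a (tensor_pi x) = tensor_pi (a *: x).
Proof.
by apply/tensor_piP; rewrite -scalerBr; apply/tensor_nullZ/tensor_repr_pi.
Qed.

Lemma tensor_ind (P : tensor -> Prop) :
  (forall x, P (tensor_pi x)) -> forall t, P t.
Proof. by move=> Ppi t; rewrite -[t]reprK; exact: Ppi. Qed.

Lemma tensor_scaleA a b t :
  tensor_scale a (tensor_scale b t) = tensor_scale (a * b) t.
Proof. by elim/tensor_ind: t => x; rewrite !tensor_scale_pi scalerA. Qed.

Lemma tensor_scale1 : left_id 1 tensor_scale.
Proof. by elim/tensor_ind => x; rewrite tensor_scale_pi scale1r. Qed.

Lemma tensor_scaleDr : right_distributive tensor_scale +%R.
Proof.
move=> a; elim/tensor_ind => x; elim/tensor_ind => y.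
by rewrite -tensor_piD !tensor_scale_pi scalerDr tensor_piD.
Qed.

Lemma tensor_scaleDl t : {morph tensor_scale^~ t : a b / a + b}.
Proof.
by elim/tensor_ind: t => x a b; rewrite !tensor_scale_pi scalerDl tensor_piD.
Qed.

HB.instance Definition _ := GRing.Zmodule_isLmodule.Build K tensor
  tensor_scaleA tensor_scale1 tensor_scaleDr tensor_scaleDl.

Lemma tensor_piZ a x : tensor_pi (a *: x) = a *: tensor_pi x.
Proof. by rewrite -tensor_scale_pi. Qed.

Lemma tensor_pi_linear : linear tensor_pi.
Proof. by move=> a x y; rewrite tensor_piD tensor_piZ. Qed.

HB.instance Definition _ :=
  GRing.isLinear.Build K tensor_free tensor *:%R tensor_pi tensor_pi_linear.

Definition tpure f v : tensor := tensor_pi (tfree f v).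

Definition multilinear (X : lmodType K) (g : {ffun 'I_m -> U} -> V -> X) : Prop :=
  (forall f i v, linear (fun u => g (upd f i u) v)) /\ (forall f, linear (g f)).

Lemma tpure_multilinear : multilinear tpure.
Proof.
split=> [f i v a u u'|f a v w]; rewrite /tpure -tensor_pi_linear.
  by apply/tensor_piP; exact: TNullU.
by apply/tensor_piP; exact: TNullV.
Qed.

(* The linear map on the tensor product induced by g; it is meaningful only for
   multilinear g, see tensor_lift_pure. *)
Definition tensor_lift (X : lmodType K) (g : {ffun 'I_m -> U} -> V -> X)
  (t : tensor) : X := lext (fun p => g p.1 p.2) (repr t).

Section Lift.
Context (X : lmodType K) (g : {ffun 'I_m -> U} -> V -> X).
Hypothesis gL : multilinear g.

Lemma lext_tensor_null x : tensor_null x -> lext (fun p => g p.1 p.2) x = 0.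
Proof.
elim=> [|a {}x y _ x0 _ y0|f i a u u' v|f a v w]; first by rewrite linear0.
- by rewrite lext_linear x0 y0 scaler0 addr0.
- by rewrite lextB lext_linear !lext_basis /= gL.1 subrr.
- by rewrite lextB lext_linear !lext_basis /= gL.2 subrr.
Qed.

Lemma tensor_lift_pi x :
  tensor_lift g (tensor_pi x) = lext (fun p => g p.1 p.2) x.
Proof.
apply/eqP; rewrite -subr_eq0 /tensor_lift -lextB.
by rewrite lext_tensor_null //; exact: tensor_repr_pi.
Qed.

Lemma tensor_lift_linear : linear (tensor_lift g).
Proof.
move=> a; elim/tensor_ind => x; elim/tensor_ind => y.
by rewrite -tensor_piZ -tensor_piD !tensor_lift_pi lext_linear.
Qed.

Lemma tensor_lift_pure f v : tensor_lift g (tpure f v) = g f v.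
Proof. by rewrite tensor_lift_pi lext_basis. Qed.

Lemma tensor_lift_uniq (h : tensor -> X) : linear h ->
  (forall f v, h (tpure f v) = g f v) -> h =1 tensor_lift g.
Proof.
move=> hL hg; elim/tensor_ind => x; rewrite tensor_lift_pi.
apply: (lext_uniq (h := fun y => h (tensor_pi y))) => [a y z|[f v]].
  by rewrite tensor_piD tensor_piZ hL.
exact: hg.
Qed.

End Lift.

(* The Lie algebra action on the tensor product, determined by
   x (f_1 (x) ... (x) f_m (x) v)
     = \sum_i f_1 (x) ... (x) x f_i (x) ... (x) f_m (x) v
       + f_1 (x) ... (x) f_m (x) x v;
   see tensor_act_pure. *)
Definition tensor_act_gen (g : lmodType K) (actU : 'I_m -> g -> U -> U)
    (actV : g -> V -> V) (x : g) f v : tensor :=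
  \sum_(i < m) tpure (upd f i (actU i x (f i))) v + tpure f (actV x v).

Definition tensor_act (g : lmodType K) (actU : 'I_m -> g -> U -> U)
    (actV : g -> V -> V) (x : g) : tensor -> tensor :=
  tensor_lift (tensor_act_gen actU actV x).

Section Action.
Context (g : lmodType K) (actU : 'I_m -> g -> U -> U) (actV : g -> V -> V).
Hypotheses (actU_linear : forall i x, linear (actU i x))
           (actV_linear : forall x, linear (actV x)).

Lemma tensor_act_multilinear x : multilinear (tensor_act_gen actU actV x).
Proof.
have [pU pV] := tpure_multilinear.
split=> [f i v a u u'|f a v w]; rewrite /tensor_act_gen.
- rewrite pU scalerDr addrACA scaler_sumr -big_split /=; congr (_ + _).
  apply: eq_bigr => j _; have [->|ji] := eqVneq j i.
    have E z : upd (upd f i z) i (actU i x (upd f i z i)) = upd f i (actU i x z).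
      by apply/ffunP => k; rewrite !ffunE eqxx; case: eqP.
    by rewrite !E actU_linear pU.
  have E z : upd (upd f i z) j (actU j x (upd f i z j))
             = upd (upd f j (actU j x (f j))) i z.
    apply/ffunP => k; rewrite !ffunE (negPf ji).
    by case: (eqVneq k j) => // ->; rewrite (negPf ji).
  by rewrite !E pU.
- rewrite actV_linear pV scalerDr addrACA scaler_sumr -big_split /=.
  by congr (_ + _); apply: eq_bigr => j _; rewrite pV.
Qed.

Lemma tensor_act_linear x : linear (tensor_act actU actV x).
Proof. exact/tensor_lift_linear/tensor_act_multilinear. Qed.

Lemma tensor_act_pure x f v : tensor_act actU actV x (tpure f v)
  = \sum_(i < m) tpure (upd f i (actU i x (f i))) v + tpure f (actV x v).
Proof. exact/tensor_lift_pure/tensor_act_multilinear. Qed.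

End Action.

End TensorProduct.

Arguments tensor {K} m U V.

Inductive Bgen := BL of int & nat | BW of int & nat | BC1 | BC2.

Definition Bgen_code (b : Bgen) : (int * nat + int * nat) + bool :=
  match b with
  | BL m i => inl (inl (m, i))
  | BW m i => inl (inr (m, i))
  | BC1 => inr true
  | BC2 => inr false
  end.

Definition Bgen_decode (c : (int * nat + int * nat) + bool) : Bgen :=
  match c with
  | inl (inl (m, i)) => BL m i
  | inl (inr (m, i)) => BW m i
  | inr true => BC1
  | inr false => BC2
  end.

Lemma Bgen_codeK : cancel Bgen_code Bgen_decode. Proof. by case. Qed.

HB.instance Definition _ := Choice.copy Bgen (can_type Bgen_codeK).

From mathcomp Require Import mpoly.

Section Block.
Context {K : fieldType}.

(* The underlying vector space of B(q); q enters only through Bbracket. *)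
Definition Block : lmodType K := {malg K[Bgen]}.

Definition Bbasis (b : Bgen) : Block := << b >>.

Definition Bcoef (q : K) (m : int) (i : nat) (n : int) (j : nat) : K :=
  n%:~R * (i%:R + q) - m%:~R * (j%:R + q).

Definition Bcocycle (m : int) (i : nat) (n : int) (j : nat) : K :=
  if ((i + j)%N == 0%N) && (m + n == 0) then (m%:~R ^+ 3 - m%:~R) / 12%:R else 0.

Definition Bbracket_gen (q : K) (a b : Bgen) : Block :=
  match a, b with
  | BL m i, BL n j => Bcoef q m i n j *: Bbasis (BL (m + n) (i + j)%N)
                      + Bcocycle m i n j *: Bbasis BC1
  | BL m i, BW n j => Bcoef q m i n j *: Bbasis (BW (m + n) (i + j)%N)
                      + Bcocycle m i n j *: Bbasis BC2
  | BW n j, BL m i => - (Bcoef q m i n j *: Bbasis (BW (m + n) (i + j)%N)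
                         + Bcocycle m i n j *: Bbasis BC2)
  | _, _ => 0
  end.

Definition Bbracket (q : K) (x y : Block) : Block :=
  lext (fun a => lext (Bbracket_gen q a) y) x.

Definition restricted (V : lmodType K) (act : Block -> V -> V) : Prop :=
  forall v : V, exists n : nat, forall (m : int) (i : nat), n%:Z < m ->
    act (Bbasis (BL m i)) v = 0 /\ act (Bbasis (BW m i)) v = 0.

(* The quotient is exact: 'X - alpha divides 'X^k - alpha ^+ k. *)
Definition hpoly (n : int) (k : nat) (alpha : K) : {poly K} :=
  n%:~R *: 'X^k
  - (n%:~R * (n%:~R - 1) * alpha) *:
    (('X^k - (alpha ^+ k)%:P) %/ ('X - alpha%:P)).

Definition inT (alpha : K) (h : int -> {poly K}) : Prop :=
  exists (N : nat) (xi : nat -> K),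
    forall m : int, h m = \sum_(i < N) xi i *: hpoly m i alpha.

(* The quotient is exact: -alpha is a root of h_1(-t) - h_1(alpha). *)
Definition Theta (alpha : K) (h : int -> {poly K}) (c : K) : {poly K} :=
  c *: (((h 1 \Po (- 'X)) - ((h 1).[alpha])%:P) %/ (- 'X - alpha%:P)).

Local Notation Cts := {mpoly K[2]}.

Definition tvar : Cts := 'X_(ord0 : 'I_2).
Definition svar : Cts := 'X_(ord_max : 'I_2).

Definition poly_t (p : {poly K}) : Cts := (map_poly (fun c => c%:MP_[2]) p).[tvar].

Definition shift_s (c : K) (f : Cts) : Cts :=
  f \mPo [tuple tvar; svar + c%:MP_[2]].

Definition partial_t (f : Cts) : Cts := f^`M(ord0 : 'I_2).

Section Omega.
Context (q lambda alpha : K) (beta gamma : K * K) (h : int -> {poly K}).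

Definition OmegaL (m : int) (i : nat) (f : Cts) : Cts :=
  (if i == 0%N then
     (lambda ^ m) *:
       ((svar + q *: poly_t (h m \Po (q^-1 *: 'X)))
        * shift_s (- (m%:~R * q)) f)
     - (m%:~R * lambda ^ m * q) *:
       ((tvar - (m%:~R * q * alpha)%:MP_[2])
        * partial_t (shift_s (- (m%:~R * q)) f))
   else 0)
  + (if (m == 0) && (i%:R == - (2%:R * q)) then gamma.2 *: f else 0)
  + (if (i == 1%N) && (q == -1) then
       (lambda ^ m) *:
         (beta.2 *: shift_s m%:~R f
          + m%:~R *: (poly_t (Theta alpha h beta.1) * shift_s m%:~R f)
          + (m%:~R * beta.1) *: partial_t (shift_s m%:~R f))
     else 0).

Definition OmegaW (m : int) (i : nat) (f : Cts) : Cts :=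
  (if i == 0%N then
     (lambda ^ m) *:
       ((tvar - (m%:~R * q * alpha)%:MP_[2]) * shift_s (- (m%:~R * q)) f)
   else 0)
  + (if (m == 0) && (i%:R == - (2%:R * q)) then gamma.1 *: f else 0)
  + (if (i == 1%N) && (q == -1) then
       (beta.1 * lambda ^ m) *: shift_s m%:~R f
     else 0).

Definition Omega_gen (b : Bgen) (f : Cts) : Cts :=
  match b with
  | BL m i => OmegaL m i f
  | BW m i => OmegaW m i f
  | BC1 | BC2 => 0
  end.

Definition Omega_act (x : Block) (f : Cts) : Cts :=
  lext (fun b => Omega_gen b f) x.

Lemma Omega_act_linear x : linear (Omega_act x).
Proof.
have sL c : linear (shift_s c) by move=> a f g; rewrite /shift_s linearP.
have dL : linear partial_t by move=> a f g; rewrite /partial_t linearP.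
have zL : linear (fun=> 0 : Cts) by move=> a f g; rewrite scaler0 addr0.
have iL : linear (id : Cts -> Cts) by [].
have DL (F G : Cts -> Cts) : linear F -> linear G -> linear (fun f => F f + G f).
  by move=> FL GL a f g; rewrite FL GL scalerDr addrACA.
have BL (F G : Cts -> Cts) : linear F -> linear G -> linear (fun f => F f - G f).
  by move=> FL GL a f g; rewrite FL GL opprD scalerBr addrACA.
have ZL (c : K) (F : Cts -> Cts) : linear F -> linear (fun f => c *: F f).
  by move=> FL a f g; rewrite FL scalerDr !scalerA mulrC.
have ML (p : Cts) (F : Cts -> Cts) : linear F -> linear (fun f => p * F f).
  by move=> FL a f g; rewrite FL mulrDr scalerAr.
have CL (F G : Cts -> Cts) : linear F -> linear G -> linear (fun f => F (G f)).
  by move=> FL GL a f g; rewrite GL FL.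
have ifL (b : bool) (F : Cts -> Cts) : linear F ->
  linear (fun f => if b then F f else 0) by case: b.
have genL b : linear (Omega_gen b).
  case: b => [m i|m i||]; try exact: zL.
  - apply: (DL); first apply: (DL); apply: (ifL); last 2 first.
    + exact: ZL.
    + apply/ZL/(DL _ _ _ (ZL _ _ (CL _ _ _ _))) => //.
      by apply: (DL); [exact/ZL | exact/ZL/ML].
    + by apply: (BL); apply/ZL/ML => //; exact: CL.
  - by apply: (DL); first apply: (DL); apply: (ifL);
      [exact/ZL/ML|exact: ZL|exact: ZL].
exact: (lext_linearr x genL).
Qed.

End Omega.

End Block.

Arguments Block K : clear implicits.

(* Main.v *)
Require Import Defs.
From HB Require Import structures.
From mathcomp Require Import all_boot all_order all_algebra.
From mathcomp Require Import boolp zify ring reals complex mpoly.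

Set Implicit Arguments.
Unset Strict Implicit.
Unset Printing Implicit Defensive.

Import Order.TTheory GRing.Theory Num.Theory.
Local Open Scope ring_scope.

(* For n large, x_{n,j} with x = L or W kills any given vector of V and acts on the
   i-th factor Omega as lambda_i^n times an operator that is polynomial in n.  The
   sequences n^k lambda_i^n being independent, when the lambda_i are distinct a
   submodule N of T is stable under these operators, applied in a single factor, at
   every complex value of n.  They generate the multiplications by t and s, the
   shifts of s, d/dt and then d/ds (the linear term of the shifts).  Differentiating
   a nonzero vector of N until it is killed by all derivatives gives some
   1 (x) ... (x) 1 (x) w in N with w <> 0; irreducibility of V yields all such
   vectors, and multiplications give all of T.
   Conversely, T is reducible in each excluded case: a submodule S of V gives the
   span of the f_1 (x) ... (x) f_m (x) v with v in S; if alpha_i = 0 and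
   beta_{1,i} = 0, the ideal generated by t is invariant in the i-th factor; and if
   lambda_i = lambda_j, the vectors fixed by the simultaneous shifts
   s_i -> s_i + c, s_j -> s_j - c form a submodule. *)

(** * Linear maps as a property of plain functions *)

Section LinearMaps.
Context {K : fieldType} {X Y : lmodType K}.
Implicit Types A B : X -> Y.

Lemma linear_prop0 A : linear A -> A 0 = 0.
Proof. by move=> AL; have := AL (-1) 0 0; rewrite scaler0 addr0 scaleN1r addNr. Qed.

Lemma linear_propD A x y : linear A -> A (x + y) = A x + A y.
Proof. by move=> AL; rewrite -[x]scale1r AL !scale1r. Qed.

Lemma linear_propZ A a x : linear A -> A (a *: x) = a *: A x.
Proof. by move=> AL; rewrite -[a *: x]addr0 AL linear_prop0 // addr0. Qed.

Lemma linear_propB A x y : linear A -> A (x - y) = A x - A y.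
Proof. by move=> AL; rewrite addrC -scaleN1r AL scaleN1r addrC. Qed.

Lemma linear_prop_sum A (I : Type) (r : seq I) (P : pred I) (F : I -> X) :
  linear A -> A (\sum_(i <- r | P i) F i) = \sum_(i <- r | P i) A (F i).
Proof.
move=> AL; apply: (big_morph A) => [x y|]; first exact: linear_propD.
exact: linear_prop0.
Qed.

Lemma linear_comp (Z : lmodType K) (A : Y -> Z) (B : X -> Y) :
  linear A -> linear B -> linear (fun x => A (B x)).
Proof. by move=> AL BL a x y; rewrite BL AL. Qed.

Lemma linear_lincomb a A B :
  linear A -> linear B -> linear (fun x => a *: A x + B x).
Proof.
by move=> AL BL b x y; rewrite AL BL !scalerDr !scalerA [a * b]mulrC addrACA.
Qed.

Lemma linear_prop_eq A B : A =1 B -> linear A -> linear B.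
Proof. by move=> /funext ->. Qed.

Lemma linear_prop_zero : linear (fun _ : X => 0 : Y).
Proof. by move=> a x y; rewrite scaler0 addr0. Qed.

End LinearMaps.

(** * Subspaces as predicates *)

Record subspace (K : fieldType) (X : lmodType K) (N : X -> Prop) : Prop := Subspace {
  subspace0 : N 0;
  subspaceP : forall (a : K) (u v : X), N u -> N v -> N (a *: u + v)
}.

Section Subspaces.
Context {K : fieldType} {X : lmodType K} {N : X -> Prop}.
Hypothesis NS : subspace N.

Lemma subspaceZ a u : N u -> N (a *: u).
Proof. by move=> Nu; rewrite -[_ *: _]addr0; apply: subspaceP => //; exact: subspace0. Qed.

Lemma subspaceD u v : N u -> N v -> N (u + v).
Proof. by move=> Nu Nv; rewrite -[u]scale1r; apply: subspaceP. Qed.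

Lemma subspaceB u v : N u -> N v -> N (u - v).
Proof. by move=> Nu Nv; rewrite addrC -scaleN1r; apply: subspaceP. Qed.

Lemma subspaceZK a u : a != 0 -> N (a *: u) -> N u.
Proof. by move=> a0 Nu; rewrite -[u](scalerK a0); apply: subspaceZ. Qed.

Lemma subspace_sum (I : eqType) (r : seq I) (P : pred I) (F : I -> X) :
  (forall i, i \in r -> P i -> N (F i)) -> N (\sum_(i <- r | P i) F i).
Proof.
move=> NF; rewrite big_seq_cond; apply: big_ind => [|u v|i /andP[ri Pi]].
- exact: subspace0.
- exact: subspaceD.
- exact: NF.
Qed.

End Subspaces.

(** * Operators acting in a single tensor factor *)

Section Slots.
Context {K : fieldType} {m : nat} {U V : lmodType K}.
Notation T := (tensor m U V).
Implicit Types (f : {ffun 'I_m -> U}) (v w : V) (x y : T) (A B : U -> U).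

(** An element of [T] is the class of a finite combination of free generators, and the classes of
    these are the pure tensors; [lext_uniq] makes the combination explicit. *)
Lemma tensor_span (P : T -> Prop) : subspace P ->
  (forall f v, P (tpure f v)) -> forall x, P x.
Proof.
move=> PS Pp; apply: (@tensor_ind K m U V) => y.
have pL := @tensor_pi_linear K m U V.
rewrite (lext_uniq (g := fun b => tpure b.1 b.2) pL) => [|[f v]//].
by apply: (subspace_sum PS) => -[f v] _ _; apply: (subspaceZ PS); exact: Pp.
Qed.

Lemma tensor_ext (X : lmodType K) (g h : T -> X) : linear g -> linear h ->
  (forall f v, g (tpure f v) = h (tpure f v)) -> g =1 h.
Proof.
move=> gL hL; apply: tensor_span; split; first by rewrite !linear_prop0.
by move=> a x y gx gy; rewrite gL hL gx gy.
Qed.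

Lemma tpure_linear_slot f i v : linear (fun u => tpure (upd f i u) v : T).
Proof. by case: (@tpure_multilinear K m U V) => [pU _]; exact: pU. Qed.

Lemma tpure_linear f : linear (fun v => tpure f v : T).
Proof. by case: (@tpure_multilinear K m U V) => [_ pV]; exact: pV. Qed.

Lemma upd_same f i : upd f i (f i) = f.
Proof. by apply/ffunP => j; rewrite !ffunE; case: eqP => // ->. Qed.

Lemma updE f i u : upd f i u i = u.
Proof. by rewrite ffunE eqxx. Qed.

Lemma upd_upd f i u u' : upd (upd f i u) i u' = upd f i u'.
Proof. by apply/ffunP => j; rewrite !ffunE; case: eqP. Qed.

Lemma updC f i j u u' : i != j -> upd (upd f i u) j u' = upd (upd f j u') i u.
Proof.
by move=> ij; apply/ffunP => k; rewrite !ffunE; case: (eqVneq k j) => // ->;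
  rewrite eq_sym (negPf ij).
Qed.

Lemma upd_neq f i j u : i != j -> upd f i u j = f j.
Proof. by move=> ij; rewrite ffunE eq_sym (negPf ij). Qed.

(* slot and slotV are opaque functions with a specification: comparing two of
   them would otherwise unfold the quotient construction of the tensor product. *)
Fact slot_key : {s : 'I_m -> (U -> U) -> T -> T | forall i A,
  s i A = tensor_lift (fun f v => tpure (upd f i (A (f i))) v)}.
Proof. by eexists. Qed.

Fact slotV_key : {s : (V -> V) -> T -> T | forall B : V -> V,
  s B = tensor_lift (fun f v => tpure f (B v))}.
Proof. by eexists. Qed.

Definition slot : 'I_m -> (U -> U) -> T -> T := sval slot_key.
Definition slotV : (V -> V) -> T -> T := sval slotV_key.

Lemma slot_multilinear i A : linear A ->
  multilinear (fun f v => tpure (upd f i (A (f i))) v : T).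
Proof.
move=> AL; split=> [f j v a u u'|f]; last exact: tpure_linear.
have [->|ij] := eqVneq i j.
  by rewrite !upd_upd !updE AL tpure_linear_slot.
by rewrite !upd_neq 1?eq_sym // !(updC _ _ _ (_ : j != i)) 1?eq_sym //
  tpure_linear_slot.
Qed.

Lemma slotV_multilinear (B : V -> V) : linear B ->
  multilinear (fun f v => tpure f (B v) : T).
Proof.
move=> BL; split=> [f j v|f a v w]; first exact: tpure_linear_slot.
by rewrite BL tpure_linear.
Qed.

Lemma slot_pure i A f v : linear A ->
  slot i A (tpure f v) = tpure (upd f i (A (f i))) v.
Proof.
move=> AL; rewrite /slot (svalP slot_key) tensor_lift_pure //.
exact: slot_multilinear.
Qed.

Lemma slotV_pure (B : V -> V) f v : linear B -> slotV B (tpure f v) = tpure f (B v).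
Proof.
move=> BL; rewrite /slotV (svalP slotV_key) tensor_lift_pure //.
exact: slotV_multilinear.
Qed.

Lemma slot_linear i A : linear A -> linear (slot i A).
Proof.
move=> AL; rewrite /slot (svalP slot_key).
exact/tensor_lift_linear/slot_multilinear.
Qed.

Lemma slotV_linear (B : V -> V) : linear B -> linear (slotV B).
Proof.
move=> BL; rewrite /slotV (svalP slotV_key).
exact/tensor_lift_linear/slotV_multilinear.
Qed.

Lemma slot_eq i A B : A =1 B -> slot i A =1 slot i B.
Proof. by move=> /funext ->. Qed.

Lemma slot_id i x : slot i id x = x.
Proof.
have idL : linear (id : U -> U) by [].
apply: (tensor_ext (g := slot i id) (h := id)) => // [|f v]; first exact: slot_linear.
by rewrite (slot_pure _ _ _ idL) upd_same.
Qed.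

Lemma slot_comp i A B x : linear A -> linear B ->
  slot i A (slot i B x) = slot i (fun u => A (B u)) x.
Proof.
move=> AL BL; have CL := linear_comp AL BL.
move: x; apply: tensor_ext.
- exact: linear_comp (slot_linear _ _) (slot_linear _ _).
- exact: slot_linear.
move=> f v; rewrite !(slot_pure _ _ _ AL, slot_pure _ _ _ BL, slot_pure _ _ _ CL).
by rewrite updE upd_upd.
Qed.

Lemma slotC i j A B x : i != j -> linear A -> linear B ->
  slot i A (slot j B x) = slot j B (slot i A x).
Proof.
move=> ij AL BL; move: x; apply: tensor_ext;
  [exact: linear_comp (slot_linear _ _) (slot_linear _ _)..|].
move=> f v; rewrite !(slot_pure _ _ _ AL, slot_pure _ _ _ BL).
have ji : j != i by rewrite eq_sym.
by rewrite (upd_neq _ _ ij) (upd_neq _ _ ji) (updC _ _ _ ij).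
Qed.

Lemma slot_slotV i A (B : V -> V) x : linear A -> linear B ->
  slot i A (slotV B x) = slotV B (slot i A x).
Proof.
move=> AL BL; move: x; apply: tensor_ext;
  [exact: linear_comp (slot_linear _ _) (slotV_linear _)|
   exact: linear_comp (slotV_linear _) (slot_linear _ _)|].
by move=> f v; rewrite !(slot_pure _ _ _ AL, slotV_pure _ _ BL).
Qed.

Lemma slot_lincomb i a A B x : linear A -> linear B ->
  slot i (fun u => a *: A u + B u) x = a *: slot i A x + slot i B x.
Proof.
move=> AL BL; have CL := linear_lincomb a AL BL; move: x; apply: tensor_ext.
- exact: slot_linear.
- by apply: linear_lincomb; exact: slot_linear.
- move=> f v; rewrite !(slot_pure _ _ _ AL, slot_pure _ _ _ BL, slot_pure _ _ _ CL).
  exact: tpure_linear_slot.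
Qed.

Lemma slot_zero i x : slot i (fun=> 0) x = 0.
Proof.
have zL : linear (fun _ : U => 0 : U) by exact: linear_prop_zero.
move: x; apply: tensor_ext; [exact: slot_linear|exact: linear_prop_zero|].
move=> f v; rewrite (slot_pure _ _ _ zL); exact: linear_prop0 (tpure_linear_slot f i v).
Qed.

Lemma slotZ i a A x : linear A -> slot i (fun u => a *: A u) x = a *: slot i A x.
Proof.
move=> AL; rewrite -[RHS]addr0 -[in RHS](slot_zero i x).
rewrite -(slot_lincomb _ _ _ AL linear_prop_zero).
by apply: slot_eq => u; rewrite addr0.
Qed.

(** Splits the action into single-factor operators, so that each factor can be treated separately.
    Linearity is asked only at the one element [z], hence multilinearity is proved afresh for it. *)
Lemma tensor_act_slot (g : lmodType K) (actU : 'I_m -> g -> U -> U)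
    (actV : g -> V -> V) z x :
  (forall i, linear (actU i z)) -> linear (actV z) ->
  tensor_act actU actV z x = \sum_(i < m) slot i (actU i z) x + slotV (actV z) x.
Proof.
move=> UL VL; have ML : multilinear (tensor_act_gen actU actV z).
  split=> [f i v a u u'|f a v w].
    rewrite /tensor_act_gen tpure_linear_slot scalerDr addrACA scaler_sumr.
    rewrite -big_split /=; congr (_ + _); apply: eq_bigr => j _.
    by have [/(_ f i v a u u') -> _] := slot_multilinear j (UL j).
  rewrite /tensor_act_gen VL tpure_linear scalerDr addrACA scaler_sumr.
  by rewrite -big_split /=; congr (_ + _); apply: eq_bigr => j _; rewrite tpure_linear.
move: x; apply: tensor_ext.
- exact: tensor_lift_linear.
- move=> a x y /=; rewrite (slotV_linear VL) scalerDr (addrACA (a *: _)).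
  rewrite scaler_sumr -big_split /=.
  by congr (_ + _); apply: eq_bigr => j _; exact: (slot_linear j (UL j)).
move=> f v; rewrite /tensor_act (tensor_lift_pure ML) (slotV_pure _ _ VL).
by congr (_ + _); apply: eq_bigr => j _; rewrite (slot_pure _ _ _ (UL j)).
Qed.

(** Contracts the polynomial factors by functionals; this is the tool that shows pure tensors to be
    nonzero and submodules to be proper. *)
Definition tensor_eval (e : 'I_m -> U -> K) : T -> V :=
  tensor_lift (fun f v => (\prod_i e i (f i)) *: v).

Lemma tensor_eval_multilinear e : (forall i, scalar (e i)) ->
  multilinear (fun f v => (\prod_i e i (f i)) *: (v : V)).
Proof.
move=> eL; split=> [f i v a u u'|f a v w]; last first.
  by rewrite scalerDr !scalerA [_ * a]mulrC.
have E z : \prod_j e j (upd f i z j) = e i z * \prod_(j | j != i) e j (f j).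
  rewrite (bigD1 i) //= updE; congr (_ * _); apply: eq_bigr => j ji.
  by rewrite upd_neq // eq_sym.
by rewrite !E eL mulrDl scalerDl scalerA mulrA.
Qed.

Lemma tensor_eval_linear e : (forall i, scalar (e i)) -> linear (tensor_eval e).
Proof. by move=> /tensor_eval_multilinear; exact: tensor_lift_linear. Qed.

Lemma tensor_eval_pure e f v : (forall i, scalar (e i)) ->
  tensor_eval e (tpure f v) = (\prod_i e i (f i)) *: v.
Proof. by move=> eL; rewrite /tensor_eval tensor_lift_pure //; exact: tensor_eval_multilinear. Qed.

End Slots.

(** * Polynomial functions with vector values *)

Section PolynomialFamilies.
Context {K : fieldType} {X : lmodType K}.
Implicit Types (u w : K -> X) (s : seq X).

Fixpoint hornerv s (x : K) : X :=
  if s is v :: s' then v + x *: hornerv s' x else 0.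

(** The equality is required at every scalar: this later allows values at large integers to be
    replaced by values at arbitrary [x]. *)
Definition polyfam u := exists s, forall x, u x = hornerv s x.

Lemma hornervE s x d : (size s <= d)%N ->
  hornerv s x = \sum_(k < d) x ^+ k *: s`_k.
Proof.
elim: s d => [|v s IHs] [|d] //= sd.
- by rewrite big_ord0.
- by rewrite big1 // => k _; rewrite nth_nil scaler0.
rewrite big_ord_recl expr0 scale1r (IHs d) // scaler_sumr; congr (_ + _).
by apply: eq_bigr => k _; rewrite scalerA -exprS.
Qed.

Lemma polyfam_const v : polyfam (fun=> v).
Proof. by exists [:: v] => x /=; rewrite scaler0 addr0. Qed.

Lemma polyfamD u w : polyfam u -> polyfam w -> polyfam (fun x => u x + w x).
Proof.
case=> s us [s' ws].
suff [r rE] : exists r, forall x, hornerv r x = hornerv s x + hornerv s' x.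
  by exists r => x; rewrite rE us ws.
elim: s s' {us ws} => [|v s IHs] [|v' s'].
- by exists [::] => x; rewrite addr0.
- by exists (v' :: s') => x; rewrite add0r.
- by exists (v :: s) => x; rewrite addr0.
have [r rE] := IHs s'; exists (v + v' :: r) => x /=.
by rewrite rE scalerDr addrACA.
Qed.

Lemma polyfamX u : polyfam u -> polyfam (fun x => x *: u x).
Proof. by case=> s us; exists (0 :: s) => x /=; rewrite us add0r. Qed.

Lemma polyfam_eq u w : u =1 w -> polyfam u -> polyfam w.
Proof. by move=> uw [s us]; exists s => x; rewrite -uw. Qed.

Lemma polyfam_sum (I : Type) (r : seq I) (u : I -> K -> X) :
  (forall i, polyfam (u i)) -> polyfam (fun x => \sum_(i <- r) u i x).
Proof.
move=> pu; elim: r => [|i r IHr].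
  by apply: polyfam_eq (polyfam_const 0) => x; rewrite big_nil.
by apply: polyfam_eq (polyfamD (pu i) IHr) => x; rewrite big_cons.
Qed.

Lemma polyfam_rescale a u : polyfam u -> polyfam (fun x => u (a * x)).
Proof.
case=> s us; suff [r rE] : exists r, forall x, hornerv r x = hornerv s (a * x).
  by exists r => x; rewrite us rE.
elim: s {us} => [|v s [r rE]]; first by exists [::].
exists (v :: map ( *:%R a) r) => x /=; congr (_ + _); rewrite -rE.
rewrite mulrC -scalerA; congr (_ *: _).
by elim: r {rE} => [|w r IHr] /=; rewrite ?scaler0 // IHr scalerDr !scalerA mulrC.
Qed.

End PolynomialFamilies.

Lemma polyfam_map (K : fieldType) (X Y : lmodType K) (A : X -> Y) u :
  linear A -> polyfam u -> polyfam (fun x => A (u x)).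
Proof.
move=> AL [s us]; exists (map A s) => x; rewrite us.
elim: s {us} => [|v s IHs] /=; first by rewrite linear_prop0.
by rewrite addrC AL IHs addrC.
Qed.

Lemma polyfamZ (K : fieldType) (X : lmodType K) (a : K) (u : K -> X) :
  polyfam u -> polyfam (fun x => a *: u x).
Proof.
apply: polyfam_map => b v w; by rewrite scalerDr !scalerA mulrC.
Qed.

(** Induction on the coefficient list of [u]: multiplying [v + x u'(x)] by [w] gives [v w] plus [x]
    times a product already treated. *)
Lemma polyfamM (K : fieldType) (X : algType K) (u w : K -> X) :
  polyfam u -> polyfam w -> polyfam (fun x => u x * w x).
Proof.
case=> s us pw; elim: s u us => [|v s IHs] u us.
  by apply: polyfam_eq (polyfam_const 0) => x; rewrite us mul0r.
have pw' : polyfam (fun x => v * w x).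
  by apply: (polyfam_map (A := fun z => v * z)) => // a y z; rewrite mulrDr scalerAr.
apply: polyfam_eq (polyfamD pw' (polyfamX (IHs (hornerv s) (fun=> erefl)))) => x.
by rewrite us mulrDl scalerAl.
Qed.

(** * The Euler operator and orders of vanishing *)

Section ThetaOperator.
Context {K : numFieldType}.
Implicit Types (p r : {poly K}) (a : K).

(** The Euler operator [X d/dX]. Its [k]-th iterate multiplies the coefficient of [X^j] by [j^k], so
    its values at [a] are combinations of the numbers [j^k a^j], as in exponential polynomials. *)
Definition thetap p := 'X * p^`().

Lemma coef_iter_thetap k p j : (iter k thetap p)`_j = p`_j * j%:R ^+ k.
Proof.
elim: k => [|k IHk]; first by rewrite expr0 mulr1.
rewrite iterS coefXM coef_deriv exprSr; case: j IHk => [|j] IHk /=.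
  by rewrite !mulr0.
by rewrite IHk mulrA mulr_natr.
Qed.

Lemma horner_iter_thetap k p a :
  (iter k thetap p).[a] = \sum_(j < size p) p`_j * (j%:R ^+ k * a ^+ j).
Proof.
rewrite (@horner_coef_wide _ (size p)).
  by apply: eq_bigr => j _; rewrite coef_iter_thetap mulrA.
apply/leq_sizeP => j pj; rewrite coef_iter_thetap.
by rewrite nth_default ?mul0r.
Qed.

(* X d/dX lowers the order of vanishing at a nonzero point by exactly one. *)
Lemma iter_thetap_root a e r k : a != 0 -> (k <= e)%N ->
  exists2 r', iter k thetap (('X - a%:P) ^+ e * r) = ('X - a%:P) ^+ (e - k) * r'
            & (r.[a] != 0 -> r'.[a] != 0).
Proof.
move=> a0; elim: k => [|k IHk] ke; first by exists r; rewrite ?subn0.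
have [r' rE ra'] := IHk (ltnW ke).
exists ((e - k)%:R *: ('X * r') + ('X - a%:P) * ('X * r'^`())).
  rewrite iterS rE /thetap derivM deriv_exp derivXsubC mul1r subnS.
  have : (0 < e - k)%N by rewrite subn_gt0.
  case: (e - k)%N => [//|d] _ /=.
  rewrite exprS scaler_nat -[_ *+ d.+1]mulr_natl -[('X * r') *+ _]mulr_natl.
  by move: ('X - a%:P) (d.+1%:R) => z y; move: (z ^+ d) => w; ring.
move=> /ra' r'a.
rewrite hornerD hornerZ !hornerM hornerX hornerXsubC subrr mul0r addr0.
rewrite mulf_neq0 ?mulf_neq0 //; by rewrite pnatr_eq0 -lt0n subn_gt0.
Qed.

Lemma iter_thetap_root0 a e r k : a != 0 -> (k < e)%N ->
  (iter k thetap (('X - a%:P) ^+ e * r)).[a] = 0.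
Proof.
move=> a0 ke; have [r' -> _] := iter_thetap_root r a0 (ltnW ke).
by rewrite hornerM horner_exp hornerXsubC subrr expr0n subn_eq0 leqNgt ke mul0r.
Qed.

Lemma iter_thetap_root_neq0 a e r : a != 0 -> r.[a] != 0 ->
  (iter e thetap (('X - a%:P) ^+ e * r)).[a] != 0.
Proof.
move=> a0 ra; have [r' -> r'a] := iter_thetap_root r a0 (leqnn e).
by rewrite subnn expr0 mul1r r'a.
Qed.

End ThetaOperator.

(** * Separating the terms of exponential polynomials modulo a subspace *)

Section ExponentialPolynomials.
Context {K : numFieldType} {X : lmodType K} {N : X -> Prop}.
Hypothesis NS : subspace N.
Context {m : nat} (lam : 'I_m -> K).
Hypotheses (lam0 : forall i, lam i != 0) (lam_inj : injective lam).
Context (d : nat) (c : 'I_m -> nat -> X) (n0 : nat).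
Hypothesis Nc : forall n, (n0 <= n)%N ->
  N (\sum_i lam i ^+ n *: \sum_(k < d) n%:R ^+ k *: c i k).

(** The vectors of [Nc] are combined with the coefficients of [p = X^n0 r] as weights: the sum of
    the [p_j j^k lam_i^j] is the value at [lam i] of the [k]-th Euler iterate of [p]. The factor
    [X^n0] removes the indices below [n0], where [Nc] gives nothing. *)
Lemma expoly_comb (r : {poly K}) :
  N (\sum_i \sum_(k < d) (iter k thetap ('X^n0 * r)).[lam i] *: c i k).
Proof.
set p := 'X^n0 * r.
have -> : \sum_i \sum_(k < d) (iter k thetap p).[lam i] *: c i k
   = \sum_(j < size p) p`_j *:
       \sum_i lam i ^+ j *: \sum_(k < d) j%:R ^+ k *: c i k.
  under [RHS]eq_bigr do rewrite scaler_sumr.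
  rewrite [RHS]exchange_big; apply: eq_bigr => i _.
  under [RHS]eq_bigr do rewrite scaler_sumr scaler_sumr.
  rewrite [RHS]exchange_big; apply: eq_bigr => k _.
  rewrite horner_iter_thetap scaler_suml; apply: eq_bigr => j _.
  by rewrite !scalerA [_ ^+ k * _]mulrC mulrA.
apply: (subspace_sum NS) => j _ _; have [jn|nj] := ltnP j n0.
  by rewrite coefXnM jn scale0r; exact: subspace0.
exact/(subspaceZ NS)/Nc.
Qed.

(** The weights are chosen to vanish to order [d] at each [lam j] with [j != i] and to order exactly
    [k] at [lam i]. Then only [c i k] and coefficients [c i l] with [l > k] survive, and descending
    induction on [k] removes the latter. *)
Lemma expoly_coef i k : (k < d)%N -> N (c i k).
Proof.
(* [e] counts the top indices already settled, namely those from [d - e] on. *)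
suff H e : forall k, (k < d)%N -> (d - e <= k)%N -> N (c i k).
  by move=> kd; apply: (H d); rewrite ?subnn.
elim: e => [|e IHe] {}k kd; first by rewrite subn0 leqNgt kd.
move=> ek; have [|ke] := leqP (d - e) k; first exact: IHe.
pose g := \prod_(j | j != i) ('X - (lam j)%:P) ^+ d.
have gi : g.[lam i] != 0.
  rewrite horner_prod; apply/prodf_neq0 => j ji.
  rewrite horner_exp hornerXsubC expf_neq0 // subr_eq0.
  by apply: contra_neq ji => /lam_inj.
pose r := ('X - (lam i)%:P) ^+ k * g.
have := expoly_comb r; rewrite (bigD1 i) //= [X in _ + X]big1 ?addr0 => [|j ji]; last first.
  apply: big1 => l _; rewrite /r /g (bigD1 j) //=.
  rewrite [_ ^+ k * (_ * _)]mulrCA ['X^n0 * _]mulrCA.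
  by rewrite iter_thetap_root0 // scale0r.
have pE : 'X^n0 * r = ('X - (lam i)%:P) ^+ k * ('X^n0 * g) by rewrite mulrCA.
rewrite pE (bigD1 (Ordinal kd)) //= => Ns.
have pi : (iter k thetap (('X - (lam i)%:P) ^+ k * ('X^n0 * g))).[lam i] != 0.
  by rewrite iter_thetap_root_neq0 // hornerM hornerXn mulf_neq0 // expf_neq0.
apply: (subspaceZK NS pi); set z := (X in N X); set y := (X in N (_ + X)) in Ns.
rewrite -[z](addrK y); apply: (subspaceB NS) => //.
apply: (subspace_sum NS) => l _ lk.
have [kl|] := ltnP k l; first by apply/(subspaceZ NS)/IHe => //; lia.
rewrite leq_eqVlt => /orP[/eqP lk'|lk'].
  by case/eqP: lk; apply/val_inj.
by rewrite iter_thetap_root0 // scale0r; exact: subspace0.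
Qed.

End ExponentialPolynomials.

(** * Taylor's formula for multivariate polynomials *)

Section MultivariateTaylor.
Context {K : numFieldType} {n : nat}.
Implicit Types (f g : {mpoly K[n]}) (i j : 'I_n).

Lemma mpoly_span (P : {mpoly K[n]} -> Prop) : subspace P -> P 1 ->
  (forall i f, P f -> P ('X_i * f)) -> forall f, P f.
Proof.
move=> PS P1 PX f; rewrite [f]mpolyE; apply: (subspace_sum PS) => u _ _.
apply: (subspaceZ PS); rewrite mpolyXE_id.
elim: (index_enum _) => [|i r IHr]; first by rewrite big_nil.
rewrite big_cons; elim: (u i) => [|k IHk]; first by rewrite expr0 mul1r.
by rewrite exprS -mulrA; apply: PX.
Qed.

(** Adds [g] to the variable [X_j]: a constant [g] gives a shift, and [g = - X_j] sets the variable
    to 0. *)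
Definition msubst j g f :=
  f \mPo [tuple 'X_i + (if i == j then g else 0) | i < n].

Lemma msubst_linear j g : linear (msubst j g).
Proof. by move=> a f f'; rewrite /msubst linearP. Qed.

Lemma msubstM j g f f' : msubst j g (f * f') = msubst j g f * msubst j g f'.
Proof. by rewrite /msubst rmorphM. Qed.

Lemma msubst1 j g : msubst j g 1 = 1.
Proof. by rewrite /msubst rmorph1. Qed.

Lemma msubstX j g i : msubst j g 'X_i = 'X_i + (if i == j then g else 0).
Proof. by rewrite /msubst comp_mpolyXU -tnth_nth tnth_mktuple. Qed.

Lemma mderiv_linear j : linear (mderiv j : {mpoly K[n]} -> _).
Proof. by move=> a f g; rewrite linearP. Qed.

Lemma mderivn_linear j l : linear (fun f => f^`M(j, l)).
Proof.
elim: l => [|l IHl] a f g; first by rewrite !mderivn0.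
by rewrite !mderivnS IHl mderiv_linear.
Qed.

(** Leibniz's rule, with two terms only because second derivatives of a variable vanish. At [l = 0]
    the truncated [l.-1] is harmless: its coefficient is 0. *)
Lemma mderivn_mulX i j l f : ('X_i * f)^`M(j, l)
  = 'X_i * f^`M(j, l) + ((i == j) * l)%:R *: f^`M(j, l.-1).
Proof.
elim: l => [|l IHl]; first by rewrite !mderivn0 muln0 scale0r addr0.
rewrite mderivnS IHl mderivD mderivM mderivZ -!mderivnS mderivX mnm1E eq_sym.
have [->|_] := eqVneq i j; last by rewrite !mul0n !scale0r mul0r add0r.
have -> : (U_(j) - U_(j) = 0)%MM by apply/mnmP => k; rewrite !mnmE subnn.
rewrite mpolyX0 !mul1n scale1r mul1r /= addrAC addrC; congr (_ + _).
case: l {IHl} => [|l] /=; first by rewrite scale0r addr0 scale1r.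
by rewrite -[in RHS]add1n natrD scalerDl scale1r.
Qed.

(** Induction on [f] by multiplication with variables: since [k / k! = 1 / (k-1)!], the extra
    Leibniz terms add up to [g] times the expansion of [f]. All truncations beyond a bound are
    covered, so that expansions of different polynomials can be added. *)
Lemma taylor j g f : exists l0, forall l, (l0 <= l)%N ->
  msubst j g f = \sum_(k < l) (k`!%:R)^-1 *: (g ^+ k * f^`M(j, k)).
Proof.
move: f; apply: mpoly_span => [|| i f [l0 IH]].
- split=> [|a f f' [l0 IH] [l1 IH']].
    exists 0%N => l _; rewrite linear_prop0; last exact: msubst_linear.
    rewrite big1 // => k _; rewrite linear_prop0; last exact: mderivn_linear.
    by rewrite mulr0 scaler0.
  exists (maxn l0 l1) => l; rewrite geq_max => /andP[h0 h1].
  rewrite msubst_linear (IH _ h0) (IH' _ h1) scaler_sumr -big_split /=.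
  apply: eq_bigr => k _; rewrite mderivn_linear mulrDr scalerDr -!scalerAr.
  by rewrite !scalerA mulrC.
- exists 1%N => -[//|l] _; rewrite msubst1 big_ord_recl /= expr0 mul1r mderivn0.
  rewrite fact0 invr1 scale1r big1 ?addr0 // => k _.
  rewrite mderivSn -mpolyC1 mderivC linear_prop0 ?mulr0 ?scaler0 //.
  exact: mderivn_linear.
exists l0.+1 => -[//|l] hl; rewrite msubstM msubstX.
under eq_bigr do rewrite mderivn_mulX mulrDr scalerDr.
rewrite big_split /= mulrDl; congr (_ + _).
  rewrite (IH l.+1 (ltnW hl)) mulr_sumr; apply: eq_bigr => k _.
  by rewrite -scalerAr mulrCA.
rewrite big_ord_recl /= muln0 scale0r mulr0 scaler0 add0r.
have [_|_] := eqVneq i j; last first.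
  by rewrite mul0r big1 // => k _; rewrite mul0n scale0r mulr0 scaler0.
rewrite (IH l hl) mulr_sumr; apply: eq_bigr => k _ /=.
rewrite -!scalerAr scalerA mulrA -exprS mul1n factS natrM invfM mulrAC mulVf ?mul1r //.
by rewrite pnatr_eq0.
Qed.

(** For [g = 1] the expansions of lengths [l] and [l + 1] have the same value, so the term of index
    [l] is zero. *)
Lemma mderivn_nilpotent j f : exists l0, forall l, (l0 <= l)%N -> f^`M(j, l) = 0.
Proof.
have [l0 Tf] := taylor j 1 f; exists l0 => l l0l.
have := Tf l.+1 (leqW l0l); rewrite big_ord_recr /= -(Tf l l0l) expr1n mul1r.
rewrite -{1}[msubst _ _ _]addr0 => /addrI/esym/eqP.
by rewrite scaler_eq0 invr_eq0 pnatr_eq0 eqn0Ngt fact_gt0 => /eqP.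
Qed.

End MultivariateTaylor.

(** * Shifts of [s] and the derivative in [t] on polynomials in two variables *)

Section BivariateOperators.
Context {K : numFieldType}.
Implicit Types (f g : {mpoly K[2]}) (c : K) (p : {poly K}).

Lemma shift_s_msubst c f : shift_s c f = msubst ord_max c%:MP f.
Proof.
rewrite /shift_s /msubst; congr (_ \mPo _); apply: eq_from_tnth => i.
rewrite tnth_mktuple; case: i => -[|[|//]] h /=; rewrite (tnth_nth 0) /=.
  rewrite addr0 /tvar; congr 'X_ _; exact: val_inj.
by rewrite /svar; congr ('X_ _ + _); exact: val_inj.
Qed.

Lemma shift_s_linear c : linear (shift_s c).
Proof. by move=> a f g; rewrite /shift_s linearP. Qed.

Lemma shift_sM c f g : shift_s c (f * g) = shift_s c f * shift_s c g.
Proof. by rewrite /shift_s rmorphM. Qed.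

Lemma shift_sC c a : shift_s c a%:MP = a%:MP.
Proof. by rewrite /shift_s comp_mpolyC. Qed.

Lemma shift_s_tvar c : shift_s c tvar = tvar.
Proof. by rewrite shift_s_msubst msubstX addr0. Qed.

Lemma shift_s_svar c : shift_s c svar = svar + c%:MP.
Proof. by rewrite shift_s_msubst msubstX eqxx. Qed.

Lemma mpoly2_span (P : {mpoly K[2]} -> Prop) : subspace P -> P 1 ->
  (forall f, P f -> P (tvar * f)) -> (forall f, P f -> P (svar * f)) ->
  forall f, P f.
Proof.
move=> PS P1 Pt Ps; apply: mpoly_span => // i f.
case: i => -[|[|//]] h; first by move=> /Pt; congr (P ('X_ _ * _)); exact: val_inj.
by move=> /Ps; congr (P ('X_ _ * _)); exact: val_inj.
Qed.

Lemma linear_mpoly2_ext (X : lmodType K) (A B : {mpoly K[2]} -> X) :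
  linear A -> linear B -> A 1 = B 1 ->
  (forall f, A f = B f -> A (tvar * f) = B (tvar * f)) ->
  (forall f, A f = B f -> A (svar * f) = B (svar * f)) -> A =1 B.
Proof.
move=> AL BL AB1 ABt ABs; apply: mpoly2_span => //; split.
  by rewrite !linear_prop0.
by move=> a f g Af Ag; rewrite AL BL Af Ag.
Qed.

Lemma shift_sD c c' f : shift_s c (shift_s c' f) = shift_s (c + c') f.
Proof.
move: f; apply: linear_mpoly2_ext => [|||f E|f E].
- exact: linear_comp (shift_s_linear _) (shift_s_linear _).
- exact: shift_s_linear.
- by rewrite -mpolyC1 !shift_sC.
- by rewrite !shift_sM !shift_s_tvar E.
- rewrite !shift_sM !shift_s_svar linear_propD ?shift_s_svar ?shift_sC ?E;
    last exact: shift_s_linear.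
  by rewrite mpolyCD addrA.
Qed.

Lemma shift_s0 f : shift_s 0 f = f.
Proof.
move: f; apply: linear_mpoly2_ext => [||//|f E|f E].
- exact: shift_s_linear.
- by [].
- by rewrite -mpolyC1 shift_sC.
- by rewrite shift_sM shift_s_tvar E.
- by rewrite shift_sM shift_s_svar E mpolyC0 addr0.
Qed.

(** Multiplying [f] by [s] multiplies its shift by [s + c], which has degree one in [c]. *)
Lemma polyfam_shift_s f : polyfam (fun c => shift_s c f).
Proof.
move: f; apply: mpoly2_span => [||f Pf|f Pf].
- split=> [|a f g Pf Pg].
    apply: polyfam_eq (polyfam_const 0) => c.
    by rewrite linear_prop0 //; exact: shift_s_linear.
  apply: polyfam_eq (polyfamD (polyfamZ a Pf) Pg) => c.
  by rewrite shift_s_linear.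
- by apply: polyfam_eq (polyfam_const 1) => c; rewrite -mpolyC1 shift_sC.
- apply: polyfam_eq (polyfamM (polyfam_const tvar) Pf) => c.
  by rewrite shift_sM shift_s_tvar.
- apply: polyfam_eq (polyfamD (polyfamM (polyfam_const svar) Pf) (polyfamX Pf)) => c.
  by rewrite shift_sM shift_s_svar mulrDl mul_mpolyC.
Qed.

Lemma partial_tE f : partial_t f = f^`M(ord0, 1).
Proof. by rewrite mderivSn mderivn0. Qed.

Lemma partial_t_linear : linear (partial_t : {mpoly K[2]} -> _).
Proof. exact: mderiv_linear. Qed.

Lemma partial_t_tvarM f : partial_t (tvar * f) = f + tvar * partial_t f.
Proof. by rewrite !partial_tE mderivn_mulX eqxx mderivn0 scale1r addrC. Qed.

Lemma partial_t_svarM f : partial_t (svar * f) = svar * partial_t f.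
Proof. by rewrite !partial_tE mderivn_mulX scale0r addr0. Qed.

Lemma partial_t1 : partial_t (1 : {mpoly K[2]}) = 0.
Proof. by rewrite /partial_t -mpolyC1 mderivC. Qed.

Lemma shift_s_partial_t c f : shift_s c (partial_t f) = partial_t (shift_s c f).
Proof.
move: f; apply: linear_mpoly2_ext => [|||f E|f E].
- exact: linear_comp (shift_s_linear _) partial_t_linear.
- exact: linear_comp partial_t_linear (shift_s_linear _).
- rewrite -[in RHS]mpolyC1 shift_sC mpolyC1 partial_t1.
  by rewrite linear_prop0 //; exact: shift_s_linear.
- rewrite partial_t_tvarM (linear_propD _ _ (shift_s_linear c)) !shift_sM.
  by rewrite shift_s_tvar partial_t_tvarM E.
rewrite partial_t_svarM !shift_sM shift_s_svar !mulrDl !mul_mpolyC.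
rewrite (linear_propD _ _ partial_t_linear) partial_t_svarM.
by rewrite (linear_propZ _ _ partial_t_linear) E.
Qed.

Lemma poly_t_linear : linear (poly_t : {poly K} -> {mpoly K[2]}).
Proof.
move=> a p r; rewrite /poly_t -/(map_poly (@mpolyC 2 K) _).
by rewrite rmorphD /= map_polyZ hornerD hornerZ /= mul_mpolyC.
Qed.

Lemma poly_tMXaddC p a : poly_t (p * 'X + a%:P) = poly_t p * tvar + a%:MP :> {mpoly K[2]}.
Proof.
rewrite /poly_t -/(map_poly (@mpolyC 2 K) _).
by rewrite rmorphD rmorphM /= map_polyX map_polyC /= !hornerE.
Qed.

Lemma shift_s_poly_t c p : shift_s c (poly_t p) = poly_t p.
Proof.
elim/poly_ind: p => [|p a IHp].
  rewrite (linear_prop0 poly_t_linear).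
  exact: linear_prop0 (shift_s_linear c).
rewrite poly_tMXaddC (linear_propD _ _ (shift_s_linear c)).
by rewrite shift_sM shift_sC shift_s_tvar IHp.
Qed.

Lemma msubst_constE f :
  msubst ord_max (- svar) (msubst ord0 (- tvar) f) = (f.@[fun=> 0])%:MP.
Proof.
move: f; apply: linear_mpoly2_ext => [|||f E|f E].
- exact: linear_comp (msubst_linear _ _) (msubst_linear _ _).
- by move=> a f g; rewrite mevalD mevalZ mpolyCD mpolyCM mul_mpolyC.
- by rewrite !msubst1 rmorph1 mpolyC1.
- by rewrite !msubstM msubstX eqxx subrr mevalM mevalXU mul0r mpolyC0
    (linear_prop0 (msubst_linear _ _)) mul0r.
- rewrite !msubstM msubstX addr0 msubstX eqxx subrr mevalM mevalXU.
  by rewrite !mul0r mpolyC0.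
Qed.

End BivariateOperators.

(** * Taylor expansion in a slot and the common kernel of the derivatives *)

Section Stabilizer.
Context {K : numFieldType} {m : nat} {V : lmodType K}.
Notation Cts := {mpoly K[2]}.
Notation T := (tensor m Cts V).
Implicit Types (A B : Cts -> Cts) (x y : T) (i : 'I_m).

(** No bound is uniform on [T], but each element is a finite sum of pure tensors, for which the
    largest of their bounds works. *)
Lemma subspace_common_bound (P : nat -> T -> Prop) :
  (forall l, subspace (P l)) ->
  (forall f v, exists l0, forall l, (l0 <= l)%N -> P l (tpure f v)) ->
  forall x, exists l0, forall l, (l0 <= l)%N -> P l x.
Proof.
move=> PS Pp; apply: tensor_span => //; split.
  by exists 0%N => l _; exact: subspace0.
move=> a x y [l0 Px] [l1 Py]; exists (maxn l0 l1) => l; rewrite geq_max => /andP[h0 h1].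
by apply: subspaceP; [exact: PS|exact: Px|exact: Py].
Qed.

Lemma subspace_eq (X Y : lmodType K) (g h : X -> Y) : linear g -> linear h ->
  subspace (fun z : X => g z = h z).
Proof.
move=> gL hL; split; first by rewrite !linear_prop0.
by move=> a x y gx gy; rewrite gL hL gx gy.
Qed.

Lemma taylor_term_linear (a : K) (g : Cts) j k :
  linear (fun f : Cts => a *: (g * f^`M(j, k))).
Proof.
move=> c f f'; rewrite mderivn_linear mulrDr scalerDr -!scalerAr.
by rewrite !scalerA mulrC.
Qed.

Lemma slot_taylor i j (g : Cts) x : exists l0, forall l, (l0 <= l)%N ->
  slot i (msubst j g) x
  = \sum_(k < l) slot i (fun f => (k`!%:R)^-1 *: (g ^+ k * f^`M(j, k))) x.
Proof.
have L k := taylor_term_linear (k`!%:R)^-1 (g ^+ k) j k.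
apply: (subspace_common_bound (P := fun l x => slot i (msubst j g) x = _)) => [l|f v].
  apply: subspace_eq; first exact/slot_linear/msubst_linear.
  move=> a y z; rewrite scaler_sumr -big_split /=.
  by apply: eq_bigr => k _; exact (slot_linear i (L k) a y z).
have [l0 Tf] := taylor j g (f i); exists l0 => l l0l.
rewrite (slot_pure _ _ _ (msubst_linear j g)) (Tf l l0l).
rewrite (linear_prop_sum _ _ _ (tpure_linear_slot f i v)).
by apply: eq_bigr => k _; rewrite (slot_pure _ _ _ (L k)).
Qed.

Lemma slot_mderivn_nilpotent i j x : exists l0, forall l, (l0 <= l)%N ->
  slot i (fun f => f^`M(j, l)) x = 0.
Proof.
have L l := @mderivn_linear K 2 j l.
apply: (subspace_common_bound (P := fun l x => slot i _ x = 0)) => [l|f v].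
  apply: (@subspace_eq _ _ _ (fun=> 0)); first exact/slot_linear/L.
  exact: linear_prop_zero.
have [l0 Nf] := mderivn_nilpotent j (f i); exists l0 => l l0l.
rewrite (slot_pure _ _ _ (L l)) (Nf l l0l).
exact: linear_prop0 (tpure_linear_slot f i v).
Qed.

(** Every Taylor term of positive index factors through the first derivative, which kills [x]. *)
Lemma slot_msubst_fix i j (g : Cts) x :
  slot i (mderiv j) x = 0 -> slot i (msubst j g) x = x.
Proof.
move=> dx; have [l0 /(_ l0.+1 (leqnSn _)) ->] := slot_taylor i j g x.
rewrite big_ord_recl big1 ?addr0 => [|k _].
  rewrite -[RHS](slot_id i); apply: slot_eq => f.
  by rewrite /= mderivn0 mul1r fact0 invr1 scale1r.
set a := _^-1; set h := g ^+ _; have L := taylor_term_linear a h j k.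
rewrite -[RHS](linear_prop0 (slot_linear i L)) -dx.
rewrite (slot_comp _ _ L (mderiv_linear j)).
by apply: slot_eq => f; rewrite mderivSn.
Qed.

Lemma iter_slot_mderiv i j l x :
  iter l (slot i (mderiv j)) x = slot i (fun f => f^`M(j, l)) x.
Proof.
elim: l => [|l IHl] /=.
  by rewrite -{1}[x](slot_id i); apply: slot_eq => f; rewrite mderivn0.
rewrite IHl (slot_comp _ _ (mderiv_linear j) (@mderivn_linear K 2 j l)).
by apply: slot_eq => f; rewrite mderivnS.
Qed.

Lemma slot_mderiv_comm i j i' j' x :
  slot i (mderiv j) (slot i' (mderiv j') x) = slot i' (mderiv j') (slot i (mderiv j) x).
Proof.
have dL j0 := @mderiv_linear K 2 j0.
have [->|ii'] := eqVneq i i'; last exact: slotC.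
rewrite !(slot_comp _ _ (dL _) (dL _)); apply: slot_eq => f; exact: mderiv_comm.
Qed.

(* By Taylor's formula such a vector is unchanged by the substitutions t := 0 and
   s := 0 in every slot. *)
Lemma slot_mderiv_ker x : (forall i j, slot i (mderiv j) x = 0) ->
  exists w, x = tpure [ffun=> 1] w.
Proof.
move=> dx; pose E (f : Cts) := (f.@[fun=> 0])%:MP_[2].
have EL : linear E.
  by move=> a f g; rewrite /E mevalD mevalZ mpolyCD mpolyCM mul_mpolyC.
have Ex i : slot i E x = x.
  rewrite -{2}(slot_msubst_fix (- svar) (dx i ord_max)).
  rewrite -{2}(slot_msubst_fix (- tvar) (dx i ord0)).
  rewrite (slot_comp _ _ (msubst_linear _ _) (msubst_linear _ _)).
  by apply: slot_eq => f; rewrite msubst_constE.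
(* [F r] takes constant terms in the slots listed in [r]; on a pure tensor these constants are moved
   into the factor in [V]. *)
pose F r y := foldr (fun i => slot i E) y r.
have FL r : linear (F r).
  by elim: r => [|i r IHr] a y z //=; rewrite IHr (slot_linear i EL).
have Fx r : F r x = x by elim: r => [|i r IHr] //=; rewrite IHr Ex.
pose G (r : seq 'I_m) (f : {ffun 'I_m -> Cts}) : {ffun 'I_m -> Cts} :=
  [ffun i => if i \in r then 1 else f i].
have Fp r f v : exists w, F r (tpure f v) = tpure (G r f) w.
  elim: r => [|i r [w IHr]] /=.
    have -> : G [::] f = f by apply/ffunP => k; rewrite ffunE.
    by exists v.
  rewrite IHr (slot_pure _ _ _ EL) /E; set c := meval _ _.
  exists (c *: w); rewrite -[c%:MP]mulr1 mul_mpolyC.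
  rewrite (linear_propZ _ _ (tpure_linear_slot (G r f) i w)).
  rewrite -(linear_propZ _ _ (tpure_linear (upd (G r f) i 1))).
  have -> : upd (G r f) i 1 = G (i :: r) f; last by [].
  by apply/ffunP => k; rewrite !ffunE in_cons; case: eqP.
rewrite -(Fx (enum 'I_m)); move: x {dx Ex Fx}; apply: tensor_span => [|f v].
  split=> [|a x y [w wE] [w' wE']].
    by exists 0; rewrite (linear_prop0 (FL _)) (linear_prop0 (tpure_linear _)).
  by exists (a *: w + w'); rewrite FL wE wE' tpure_linear.
have [w ->] := Fp (enum 'I_m) f v; exists w.
have -> : G (enum 'I_m) f = [ffun=> 1]; last by [].
by apply/ffunP => i; rewrite !ffunE mem_enum.
Qed.
End Stabilizer.

(** * Operators that preserve a subspace when applied in one slot *)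

Section StabilizedSubspace.
Context {K : numFieldType} {m : nat} {V : lmodType K}.
Notation Cts := {mpoly K[2]}.
Notation T := (tensor m Cts V).
Context {N : T -> Prop}.
Hypothesis NS : subspace N.
Implicit Types (A B : Cts -> Cts) (x y : T) (i : 'I_m).

(** For fixed [i] these operators form a unital algebra. Linearity is included because [slot] is
    specified only on linear operators. *)
Definition stab i A := linear A /\ forall x, N x -> N (slot i A x).

Lemma stab_eq i A B : A =1 B -> stab i A -> stab i B.
Proof. by move=> /funext ->. Qed.

Lemma stab_id i : stab i id.
Proof. by split=> // x; rewrite slot_id. Qed.

Lemma stab_zero i : stab i (fun=> 0).
Proof.
by split=> [|x _]; [exact: linear_prop_zero | rewrite slot_zero; exact: subspace0].
Qed.

Lemma stab_comp i A B : stab i A -> stab i B -> stab i (fun f => A (B f)).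
Proof.
move=> [AL NA] [BL NB]; split; first exact: linear_comp.
by move=> x Nx; rewrite -(slot_comp _ _ AL BL); apply/NA/NB.
Qed.

Lemma stab_lincomb i a A B : stab i A -> stab i B -> stab i (fun f => a *: A f + B f).
Proof.
move=> [AL NA] [BL NB]; split; first exact: linear_lincomb.
move=> x Nx; rewrite (slot_lincomb _ _ _ AL BL).
by apply: subspaceP => //; [exact: NA | exact: NB].
Qed.

Lemma stabD i A B : stab i A -> stab i B -> stab i (fun f => A f + B f).
Proof.
by move=> sA sB; apply: stab_eq (stab_lincomb 1 sA sB) => f; rewrite scale1r.
Qed.

Lemma stabZ i a A : stab i A -> stab i (fun f => a *: A f).
Proof.
by move=> sA; apply: stab_eq (stab_lincomb a sA (stab_zero i)) => f; rewrite addr0.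
Qed.

Lemma stabB i A B : stab i A -> stab i B -> stab i (fun f => A f - B f).
Proof.
by move=> sA sB; apply: stab_eq (stabD sA (stabZ (-1) sB)) => f; rewrite scaleN1r.
Qed.

Lemma stabZK i a A : a != 0 -> stab i (fun f => a *: A f) -> stab i A.
Proof.
by move=> a0 sA; apply: stab_eq (stabZ a^-1 sA) => f; rewrite scalerK.
Qed.

Lemma stab_mulmp i : stab i (fun f => tvar * f) -> stab i (fun f => svar * f) ->
  forall g, stab i (fun f => g * f).
Proof.
move=> st ss; apply: mpoly2_span => [||g sg|g sg].
- split; first by apply: stab_eq (stab_zero i) => f; rewrite mul0r.
  move=> a g h sg sh; apply: stab_eq (stab_lincomb a sg sh) => f.
  by rewrite mulrDl scalerAl.
- by apply: stab_eq (stab_id i) => f; rewrite mul1r.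
- by apply: stab_eq (stab_comp st sg) => f; rewrite mulrA.
- by apply: stab_eq (stab_comp ss sg) => f; rewrite mulrA.
Qed.

Lemma slot_polyfam i (Phi : K -> Cts -> Cts) : (forall c, linear (Phi c)) ->
  (forall f, polyfam (fun c => Phi c f)) ->
  forall x, polyfam (fun c => slot i (Phi c) x).
Proof.
move=> PhiL PhiP; apply: tensor_span => [|f v]; last first.
  apply: polyfam_eq (polyfam_map (tpure_linear_slot f i v) (PhiP (f i))) => c.
  by rewrite (slot_pure _ _ _ (PhiL c)).
split=> [|a x y px py].
  apply: polyfam_eq (polyfam_const 0) => c.
  by rewrite (linear_prop0 (slot_linear i (PhiL c))).
apply: polyfam_eq (polyfamD (polyfamZ a px) py) => c.
by rewrite (slot_linear i (PhiL c)).
Qed.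

(** The hypothesis concerns only the sum over all slots at large integers. Expanding each slot in
    powers of [n] gives an exponential polynomial; its coefficients lie in [N] one by one, and
    recombining them reaches a single slot at an arbitrary scalar [c]. *)
Lemma stab_family (lam : 'I_m -> K) (Phi : 'I_m -> K -> Cts -> Cts) :
  (forall i, lam i != 0) -> injective lam ->
  (forall i c, linear (Phi i c)) -> (forall i f, polyfam (fun c => Phi i c f)) ->
  (forall x, N x -> exists n0, forall n, (n0 <= n)%N ->
     N (\sum_i lam i ^+ n *: slot i (Phi i n%:R) x)) ->
  forall i c, stab i (Phi i c).
Proof.
move=> lam0 lam_inj PhiL PhiP NPhi i c; split=> // x Nx.
have [n0 Nn] := NPhi x Nx.
have [s sE] : exists s : 'I_m -> seq T, forall i c, slot i (Phi i c) x = hornerv (s i) c.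
  have /choice[s sE] i' : exists s, forall c', slot i' (Phi i' c') x = hornerv s c'.
    exact: slot_polyfam.
  by exists s.
pose d := \max_i size (s i).
have sd j : (size (s j) <= d)%N by exact: leq_bigmax.
rewrite sE (hornervE _ (sd i)); apply: (subspace_sum NS) => k _ _.
apply: (subspaceZ NS).
refine (expoly_coef NS lam0 lam_inj (c := fun j k => (s j)`_k) (n0 := n0) _ _
  (ltn_ord k)).
move=> n n0n; rewrite (eq_bigr (fun j => lam j ^+ n *: slot j (Phi j n%:R) x)).
  exact: Nn.
by move=> j _; rewrite sE (hornervE _ (sd j)).
Qed.

(** The shift by [c] is the exponential of [c d/ds]. On a given vector it is a polynomial in [c]
    whose linear coefficient is the derivative, and the coefficients are extracted from the values
    at integers. *)
Lemma stab_mderiv_s i : (forall c, stab i (shift_s c)) -> stab i (mderiv ord_max).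
Proof.
move=> sh; split=> [|x Nx]; first exact: mderiv_linear.
pose A k (f : Cts) := (k`!%:R)^-1 *: f^`M(ord_max, k).
have AL k : linear (A k).
  by move=> a f g; rewrite /A mderivn_linear scalerDr !scalerA mulrC.
have slE c : exists l0, forall l, (l0 <= l)%N ->
    slot i (shift_s c) x = \sum_(k < l) c ^+ k *: slot i (A k) x.
  have [l0 Tx] := slot_taylor i ord_max c%:MP x; exists l0 => l /Tx {Tx}.
  rewrite (slot_eq _ (shift_s_msubst c)) => ->; apply: eq_bigr => k _.
  have ZL : linear (fun f : Cts => 0 : Cts) by exact: linear_prop_zero.
  rewrite -[RHS]addr0 -[in RHS](slot_zero i x) -(slot_lincomb _ _ _ (AL k) ZL).
  apply: slot_eq => f; rewrite /A addr0 -(rmorphXn (@mpolyC 2 K)) mul_mpolyC !scalerA.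
  by rewrite mulrC.
(* The truncation order in [slE] depends on [c]; nilpotency of the derivative on [x] replaces it by
   one valid for all [c]. Taking [l0.+2] terms ensures that index 1 occurs. *)
have [l0 kx] := slot_mderivn_nilpotent i ord_max x.
have slE' c : slot i (shift_s c) x = \sum_(k < l0.+2) c ^+ k *: slot i (A k) x.
  have [l1 /(_ (maxn l0.+2 l1) (leq_maxr _ _)) ->] := slE c.
  rewrite (big_ord_widen _ (fun k => c ^+ k *: slot i (A k) x) (leq_maxl l0.+2 l1)).
  rewrite [in RHS]big_mkcond; apply: eq_bigr => k _; case: ltnP => // lk.
  have ZL : linear (fun f : Cts => 0 : Cts) by exact: linear_prop_zero.
  have -> : slot i (A k) x = 0; last by rewrite scaler0.
  rewrite -[RHS](scaler0 _ (k`!%:R)^-1) -(kx k (leq_trans (leqW (leqnSn l0)) lk)).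
  have mL := @mderivn_linear K 2 ord_max k.
  rewrite -[RHS]addr0 -[in RHS](slot_zero i x) -(slot_lincomb _ _ _ mL ZL).
  by apply: slot_eq => f; rewrite /A addr0.
have <- : slot i (A 1%N) x = slot i (mderiv ord_max) x.
  by apply: slot_eq => f; rewrite /A -[1`!]/1%N invr1 scale1r mderivSn mderivn0.
(* A polynomial sequence is an exponential polynomial with the single base 1. *)
have l1 : forall j : 'I_1, (1 : K) != 0 by move=> _; exact: oner_neq0.
have linj : injective (fun _ : 'I_1 => 1 : K) by move=> j j' _; rewrite !ord1.
refine (expoly_coef NS l1 linj (d := l0.+2) (c := fun _ k => slot i (A k) x)
  (n0 := 0) _ ord0 (isT : (1 < l0.+2)%N)).
move=> n _; rewrite big_ord1 expr1n scale1r -slE'.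
by case: (sh n%:R) => _; apply.
Qed.

(** Each derivative in turn is applied as often as possible without reaching 0. Derivatives commute,
    so those already annihilating the vector still do so. *)
Lemma mderiv_common_kernel : (forall i j, stab i (mderiv j)) ->
  forall r : seq ('I_m * 'I_2), (exists2 x, N x & x <> 0) ->
  exists x, [/\ N x, x <> 0 & forall p, p \in r -> slot p.1 (mderiv p.2) x = 0].
Proof.
move=> sd; elim=> [|[i j] r IHr] hx; first by have [x Nx x0] := hx; exists x.
have [x [Nx x0 xr]] := IHr hx.
pose D := slot i (mderiv j) : T -> T.
have [l0 /(_ l0 (leqnn _)) kx] := slot_mderivn_nilpotent i j x.
have ex : exists l, iter l D x == 0 by exists l0; rewrite iter_slot_mderiv kx.
have [l /eqP Dl lmin] := ex_minnP ex.
case: l Dl lmin => [|l] Dl lmin; first by case: x0.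
have NDl k : N (iter k D x).
  by elim: k => [//|k IHk] /=; case: (sd i j) => _; exact.
exists (iter l D x); split; [exact: NDl | by move/eqP/lmin; rewrite ltnn |].
move=> p; rewrite in_cons => /orP[/eqP -> //|/xr px].
elim: l {Dl lmin NDl} => [//|l IHl] /=.
rewrite slot_mderiv_comm IHl; exact: linear_prop0 (slot_linear i (mderiv_linear j)).
Qed.

Lemma stable_has_pure1 : (forall i j, stab i (mderiv j)) ->
  (exists2 x, N x & x <> 0) -> exists2 w, N (tpure [ffun=> 1] w) & w <> 0.
Proof.
move=> sd hx.
have [x [Nx x0 xk]] := mderiv_common_kernel sd (enum {: 'I_m * 'I_2}) hx.
have [w wE] : exists w, x = tpure [ffun=> 1] w.
  by apply: slot_mderiv_ker => i j; apply: (xk (i, j)); rewrite mem_enum.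
exists w; first by rewrite -wE.
by move=> w0; apply: x0; rewrite wE w0; exact: linear_prop0 (tpure_linear _).
Qed.

(** The polynomials [f i] are multiplied into the tensor of ones one slot at a time; [F r] is the
    stage where the slots of [r] are done. *)
Lemma stable_pure w : (forall i g, stab i (fun f => g * f)) ->
  N (tpure [ffun=> 1] w) -> forall f, N (tpure f w).
Proof.
move=> sm N1 f.
pose F (r : seq 'I_m) : {ffun 'I_m -> Cts} := [ffun i => if i \in r then f i else 1].
have -> : f = F (enum 'I_m) by apply/ffunP => i; rewrite ffunE mem_enum.
elim: (enum 'I_m) => [|i r IHr].
  by have -> : F [::] = [ffun=> 1] by apply/ffunP => i; rewrite !ffunE.
have [ir|ir] := boolP (i \in r).
  have -> : F (i :: r) = F r; last exact: IHr.
  apply/ffunP => k; rewrite !ffunE in_cons.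
  by case: (eqVneq k i) => // ->; rewrite ir.
have [mL /(_ _ IHr)] := sm i (f i); rewrite (slot_pure _ _ _ mL).
have -> : upd (F r) i (f i * F r i) = F (i :: r) by
  apply/ffunP => k; rewrite !ffunE in_cons (negPf ir) mulr1; case: (eqVneq k i) => // ->.
by [].
Qed.

End StabilizedSubspace.

(** * Reduction to the generators of the Block algebra *)

Section BlockAlgebra.
Context {K : fieldType}.

Lemma block_span (P : Block K -> Prop) : subspace P ->
  (forall b, P (Bbasis b)) -> forall z, P z.
Proof.
move=> PS Pb z; have -> : z = lext Bbasis z.
  exact: (@lext_uniq K _ (Block K) Bbasis id _ _ z).
by apply: (subspace_sum PS) => b _ _; apply: (subspaceZ PS).
Qed.

Lemma Omega_act_basis (q lambda alpha : K) beta gamma h b f :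
  Omega_act q lambda alpha beta gamma h (Bbasis b) f
  = Omega_gen q lambda alpha beta gamma h b f.
Proof. exact: lext_basis. Qed.

Lemma Omega_act_linearl (q lambda alpha : K) beta gamma h f :
  linear (fun z => Omega_act q lambda alpha beta gamma h z f).
Proof. exact: lext_linear. Qed.

End BlockAlgebra.

(** * The actions of the generators as polynomial families *)

Section OmegaFamilies.
Context {K : numFieldType}.
Notation Cts := {mpoly K[2]}.
Implicit Types (q alpha c : K) (f : Cts) (h : int -> {poly K}).

(* The action of W_{n,0} is lambda^n times the value at c = n of a family that
   is polynomial in c, and similarly for L_{n,0}, W_{n,1} and L_{n,1}. *)
Definition famW0 q alpha c f : Cts :=
  (tvar - (c * q * alpha)%:MP) * shift_s (- (c * q)) f.

Definition famL0 q alpha (hc : K -> {poly K}) c f : Cts :=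
  (svar + q *: poly_t (hc c \Po (q^-1 *: 'X))) * shift_s (- (c * q)) f
  - (c * q) *: ((tvar - (c * q * alpha)%:MP) * partial_t (shift_s (- (c * q)) f)).

Definition famW1 (b1 : K) c f : Cts := b1 *: shift_s c f.

Definition famL1 (b1 b2 : K) (th : {poly K}) c f : Cts :=
  b2 *: shift_s c f + c *: (poly_t th * shift_s c f)
  + (c * b1) *: partial_t (shift_s c f).

Lemma linearD (A B : Cts -> Cts) : linear A -> linear B -> linear (fun f => A f + B f).
Proof. by move=> AL BL a f g; rewrite AL BL scalerDr addrACA. Qed.

Lemma linearZl a (A : Cts -> Cts) : linear A -> linear (fun f => a *: A f).
Proof. by move=> AL b f g; rewrite AL scalerDr !scalerA mulrC. Qed.

Lemma linearMl (g : Cts) (A : Cts -> Cts) : linear A -> linear (fun f => g * A f).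
Proof. by move=> AL b f f'; rewrite AL mulrDr scalerAr. Qed.

Lemma linear_shift_partial c : linear (fun f : Cts => partial_t (shift_s c f)).
Proof. exact: linear_comp partial_t_linear (shift_s_linear c). Qed.

Lemma famW0_linear q alpha c : linear (famW0 q alpha c).
Proof. exact/linearMl/shift_s_linear. Qed.

Lemma famL0_linear q alpha hc c : linear (famL0 q alpha hc c).
Proof.
pose A f := (svar + q *: poly_t (hc c \Po (q^-1 *: 'X))) * shift_s (- (c * q)) f
  + (- (c * q)) *: ((tvar - (c * q * alpha)%:MP) * partial_t (shift_s (- (c * q)) f)).
apply: (@linear_prop_eq _ _ _ A) => [f|]; first by rewrite /A /famL0 scaleNr.
by apply: linearD; [|apply: linearZl]; apply: linearMl;
  [exact: shift_s_linear | exact: linear_shift_partial].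
Qed.

Lemma famW1_linear b1 c : linear (famW1 b1 c).
Proof. exact/linearZl/shift_s_linear. Qed.

Lemma famL1_linear b1 b2 th c : linear (famL1 b1 b2 th c).
Proof.
apply: linearD; first apply: linearD; apply: linearZl.
- exact: shift_s_linear.
- exact/linearMl/shift_s_linear.
- exact: linear_shift_partial.
Qed.

Lemma polyfamMs a b (u : K -> Cts) : polyfam u -> polyfam (fun c => (c * a * b) *: u c).
Proof.
move=> pu; apply: polyfam_eq (polyfamX (polyfamZ (a * b) pu)) => c.
by rewrite scalerA mulrA.
Qed.

Lemma polyfam_shift_scaled q f : polyfam (fun c => shift_s (- (c * q)) f).
Proof.
apply: polyfam_eq (polyfam_rescale (- q) (polyfam_shift_s f)) => c.
by rewrite mulNr mulrC.
Qed.

Lemma polyfam_tvar_sub q alpha : polyfam (fun c => tvar - (c * q * alpha)%:MP : Cts).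
Proof.
apply: polyfam_eq (polyfamD (polyfam_const tvar)
  (polyfamZ (-1) (polyfamMs q alpha (polyfam_const 1)))) => c.
by rewrite scaleN1r -mul_mpolyC mulr1.
Qed.

Lemma polyfam_famW0 q alpha f : polyfam (fun c => famW0 q alpha c f).
Proof. exact: polyfamM (polyfam_tvar_sub q alpha) (polyfam_shift_scaled q f). Qed.

Lemma polyfam_famL0 q alpha hc f : polyfam hc -> polyfam (fun c => famL0 q alpha hc c f).
Proof.
move=> ph; have pp : polyfam (fun c => q *: poly_t (hc c \Po (q^-1 *: 'X)) : Cts).
  apply/polyfamZ/(polyfam_map poly_t_linear).
  by apply: (polyfam_map (A := fun p => p \Po (q^-1 *: 'X))) ph => a p r;
    rewrite linearP.
have pd := polyfamM (polyfam_tvar_sub q alpha)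
  (polyfam_map partial_t_linear (polyfam_shift_scaled q f)).
have pL := polyfamM (polyfamD (polyfam_const svar) pp) (polyfam_shift_scaled q f).
apply: polyfam_eq (polyfamD pL (polyfamMs q (-1) pd)) => c.
by rewrite /famL0 mulrN1 scaleNr.
Qed.

Lemma polyfam_famW1 b1 f : polyfam (fun c => famW1 b1 c f).
Proof. exact/polyfamZ/polyfam_shift_s. Qed.

Lemma polyfam_famL1 b1 b2 th f : polyfam (fun c => famL1 b1 b2 th c f).
Proof.
apply: polyfamD; first apply: polyfamD.
- exact/polyfamZ/polyfam_shift_s.
- exact/polyfamX/(polyfamM (polyfam_const _))/polyfam_shift_s.
apply: polyfam_eq (polyfamMs b1 1 (polyfam_map partial_t_linear (polyfam_shift_s f))) => c.
by rewrite mulr1.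
Qed.

(** The defining formula is quadratic in [n], with a quotient [Q i] free of [n], so the integer can
    be replaced by a scalar [c]. *)
Lemma inT_polyfam alpha h : inT alpha h ->
  exists2 hc, polyfam hc & forall n : nat, h n = hc n%:R.
Proof.
case=> d [xi hE].
pose Q i := ('X^i - (alpha ^+ i)%:P) %/ ('X - alpha%:P).
pose hc c := \sum_(i < d) xi i *: (c *: 'X^i - (c * (c - 1) * alpha) *: Q i).
exists hc => [|n]; last by rewrite hE.
apply: polyfam_sum => i; apply: polyfamZ.
have p1 := polyfamX (polyfam_const ('X^i : {poly K})).
have p2 := polyfamZ alpha (polyfamX (polyfam_const (Q i))).
have p3 := polyfamZ (- alpha) (polyfamX (polyfamX (polyfam_const (Q i)))).
apply: polyfam_eq (polyfamD p1 (polyfamD p2 p3)) => c.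
congr (_ + _).
rewrite !scalerA -scalerDl -scaleNr; congr (_ *: _); ring.
Qed.

Section Values.
Context (q lambda alpha : K) (beta gamma : K * K) (h : int -> {poly K}).
Context (n : nat) (n0 : (0 < n)%N).

(** Positivity of [n] discards the [gamma] summands, which occur only in degree 0. *)
Let nz : (n%:Z == 0) = false.
Proof. by rewrite eqz_nat eqn0Ngt n0. Qed.

Lemma OmegaW0_fam f : OmegaW q lambda alpha beta gamma n 0 f
  = lambda ^+ n *: famW0 q alpha n%:R f.
Proof. by rewrite /OmegaW nz /= !addr0. Qed.

Lemma OmegaL0_fam hc f : h n = hc n%:R ->
  OmegaL q lambda alpha beta gamma h n 0 f
  = lambda ^+ n *: famL0 q alpha hc n%:R f.
Proof.
move=> hE; rewrite /OmegaL nz /= !addr0 /famL0 scalerBr hE scalerA.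
by congr (_ - _ *: _); rewrite mulrCA mulrA.
Qed.

Lemma OmegaW1_fam f : q = -1 -> OmegaW q lambda alpha beta gamma n 1 f
  = lambda ^+ n *: famW1 beta.1 n%:R f.
Proof. by move=> ->; rewrite /OmegaW nz /= eqxx !add0r /famW1 scalerA [_ * beta.1]mulrC. Qed.

Lemma OmegaL1_fam f : q = -1 -> OmegaL q lambda alpha beta gamma h n 1 f
  = lambda ^+ n *: famL1 beta.1 beta.2 (Theta alpha h beta.1) n%:R f.
Proof. by move=> ->; rewrite /OmegaL nz /= eqxx !add0r. Qed.

End Values.

End OmegaFamilies.

(* The actions of the generators are abstract families genU and genV, so that
   conversion never unfolds Bbasis and Omega_act. *)
Section TensorModule.
Context {K : numFieldType} {m : nat} {V : lmodType K}.
Notation Cts := {mpoly K[2]}.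
Notation T := (tensor m Cts V).
Context (actU : 'I_m -> Block K -> Cts -> Cts) (actV : Block K -> V -> V).
Context (genU : 'I_m -> Bgen -> Cts -> Cts) (genV : Bgen -> V -> V).
Hypotheses (actUL : forall i z, linear (actU i z)) (actVL : forall z, linear (actV z)).
Hypotheses (actU_gen : forall i b f, actU i (Bbasis b) f = genU i b f)
           (actV_gen : forall b v, actV (Bbasis b) v = genV b v).
Notation act := (tensor_act actU actV).

Lemma tact_slot z (x : T) :
  act z x = \sum_(i < m) slot i (actU i z) x + slotV (actV z) x.
Proof. exact: tensor_act_slot. Qed.

Lemma genU_linear i b : linear (genU i b).
Proof. by apply: linear_prop_eq (actUL i (Bbasis b)) => f; exact: actU_gen. Qed.

Lemma genV_linear b : linear (genV b).
Proof. by apply: linear_prop_eq (actVL (Bbasis b)) => f; exact: actV_gen. Qed.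

Lemma tact_gen b (x : T) :
  act (Bbasis b) x = \sum_(i < m) slot i (genU i b) x + slotV (genV b) x.
Proof.
have EV : actV (Bbasis b) = genV b by apply: funext => v; exact: actV_gen.
have EU i : actU i (Bbasis b) = genU i b by apply: funext => f; exact: actU_gen.
refine (eq_trans (tact_slot (Bbasis b) x) _); rewrite EV.
by refine (congr1 (fun y => y + _) _); apply: eq_bigr => i _; rewrite EU.
Qed.

Lemma submodule_subspace (N : T -> Prop) : submodule act N -> subspace N.
Proof. by move=> [N0 NP _]; exact (Subspace N0 NP). Qed.

Lemma submodule_gen (N : T -> Prop) b x : submodule act N -> N x ->
  N (\sum_(i < m) slot i (genU i b) x + slotV (genV b) x).
Proof.
by move=> Nsub Nx; rewrite -tact_gen; exact: submodule_act Nsub _ _ Nx.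
Qed.

(** * Sufficiency of the three conditions *)

Section Sufficiency.
Context (q : K) (q0 : q != 0) (lambda alpha b1 b2 : 'I_m -> K) (th : 'I_m -> {poly K}).
Hypotheses (lambda0 : forall i, lambda i != 0) (lambda_inj : injective lambda).
Hypotheses
  (genW0 : forall i n f, (0 < n)%N ->
     genU i (BW n%:Z 0) f = lambda i ^+ n *: famW0 q (alpha i) n%:R f)
  (genL0 : forall i, exists hc, polyfam hc /\ forall (n : nat) f, (0 < n)%N ->
     genU i (BL n%:Z 0) f = lambda i ^+ n *: famL0 q (alpha i) hc n%:R f)
  (genW1 : forall i n f, (0 < n)%N -> q = -1 ->
     genU i (BW n%:Z 1) f = lambda i ^+ n *: famW1 (b1 i) n%:R f)
  (genL1 : forall i n f, (0 < n)%N -> q = -1 ->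
     genU i (BL n%:Z 1) f = lambda i ^+ n *: famL1 (b1 i) (b2 i) (th i) n%:R f)
  (genV0 : forall v, exists n0, forall n : nat, (n0 < n)%N -> forall j,
     genV (BL n j) v = 0 /\ genV (BW n j) v = 0).
Hypothesis hab : forall i, alpha i != 0 \/ (q = -1 /\ b1 i != 0).
Context {N : T -> Prop} (Nsub : submodule act N).
Let NS : subspace N := submodule_subspace Nsub.
Notation stab := (@stab K m V N).
Let gVL b : linear (genV b) := genV_linear b.

Lemma restricted_slotV (x : T) : exists n0, forall n : nat, (n0 < n)%N -> forall j,
  slotV (genV (BL n j)) x = 0 /\ slotV (genV (BW n j)) x = 0.
Proof.
move: x; apply: tensor_span; first split.
- exists 0%N => n _ j; split; exact: linear_prop0 (slotV_linear (gVL _)).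
- move=> a x y [n0 Hx] [n1 Hy]; exists (maxn n0 n1) => n; rewrite gtn_max.
  move=> /andP[h0 h1] j; have [x1 x2] := Hx n h0 j; have [y1 y2] := Hy n h1 j.
  by split; rewrite (slotV_linear (gVL _)) ?x1 ?x2 ?y1 ?y2 scaler0 addr0.
move=> f v; have [n0 Hn] := genV0 v; exists n0 => n hn j.
have [v1 v2] := Hn n hn j; rewrite !(slotV_pure _ _ (gVL _)) v1 v2.
by rewrite (linear_prop0 (tpure_linear f)).
Qed.

(** For large [n] the factor [V] contributes nothing, so membership of the image under [gen n] is
    exactly the hypothesis of [stab_family]. *)
Lemma stab_generators (gen : nat -> Bgen) (Phi : 'I_m -> K -> Cts -> Cts) :
  (forall i c, linear (Phi i c)) -> (forall i f, polyfam (fun c => Phi i c f)) ->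
  (forall n i f, (0 < n)%N -> genU i (gen n) f = lambda i ^+ n *: Phi i n%:R f) ->
  (forall x : T, exists n0, forall n, (n0 < n)%N ->
     slotV (genV (gen n)) x = 0) ->
  forall i c, stab i (Phi i c).
Proof.
move=> PhiL PhiP genE gen0; apply: (stab_family NS lambda0 lambda_inj) => // x Nx.
have [n0 Hn0] := gen0 x; exists n0.+1 => n hn.
have n_gt0 : (0 < n)%N by apply: leq_trans hn.
have := submodule_gen (gen n) Nsub Nx; rewrite (Hn0 n hn) addr0.
rewrite (eq_bigr (fun i => lambda i ^+ n *: slot i (Phi i n%:R) x)); first by apply.
move=> i _; rewrite -(slotZ _ _ _ (PhiL i n%:R)); apply: slot_eq => f.
exact: genE.
Qed.

Lemma stab_famW0 i c : stab i (famW0 q (alpha i) c).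
Proof.
apply: (stab_generators (gen := fun n => BW n 0)
  (Phi := fun i => famW0 q (alpha i))) => [j d|j f|n j f n0|x].
- exact: famW0_linear.
- exact: polyfam_famW0.
- exact: genW0.
- have [n0 Hn] := restricted_slotV x; exists n0 => n /Hn/(_ 0%N) [_ E]; exact: E.
Qed.

Lemma stab_famL0 i : exists hc, forall c, stab i (famL0 q (alpha i) hc c).
Proof.
have /choice[hc hcE] := genL0.
exists (hc i); apply: (stab_generators (gen := fun n => BL n 0)
  (Phi := fun i => famL0 q (alpha i) (hc i))) => [j d|j f|n j f n0|x].
- exact: famL0_linear.
- by apply: polyfam_famL0; case: (hcE j).
- by case: (hcE j) => _; exact.
- have [n0 Hn] := restricted_slotV x; exists n0 => n /Hn/(_ 0%N) [E _]; exact: E.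
Qed.

Lemma stab_famW1 i c : q = -1 -> stab i (famW1 (b1 i) c).
Proof.
move=> qN1; apply: (stab_generators (gen := fun n => BW n 1)
  (Phi := fun i => famW1 (b1 i))) => [j d|j f|n j f n0|x].
- exact: famW1_linear.
- exact: polyfam_famW1.
- exact: genW1.
- have [n0 Hn] := restricted_slotV x; exists n0 => n /Hn/(_ 1%N) [_ E]; exact: E.
Qed.

Lemma stab_famL1 i c : q = -1 ->
  stab i (famL1 (b1 i) (b2 i) (th i) c).
Proof.
move=> qN1; apply: (stab_generators (gen := fun n => BL n 1)
  (Phi := fun i => famL1 (b1 i) (b2 i) (th i)))
  => [j d|j f|n j f n0|x].
- exact: famL1_linear.
- exact: polyfam_famL1.
- exact: genL1.
- have [n0 Hn] := restricted_slotV x; exists n0 => n /Hn/(_ 1%N) [E _]; exact: E.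
Qed.

(** At [c = 0] both the shift and the constant disappear from the family of the [W_{n,0}]. *)
Lemma stab_tvar i : stab i (fun f => tvar * f).
Proof.
apply: stab_eq (stab_famW0 i 0) => f.
rewrite /famW0 (_ : - (0 * q) = 0); last by rewrite mul0r oppr0.
by rewrite shift_s0 !mul0r mpolyC0 subr0.
Qed.

(* For alpha <> 0 the products W_c W_c' and W_0 W_(c+c') differ by a nonzero
   multiple of a shift. *)
Lemma stab_shift_s i d : stab i (shift_s d).
Proof.
have [ai|[qN1 bi]] := hab i; last exact: (stabZK NS (A := shift_s d) bi (stab_famW1 i d qN1)).
have [->|d0] := eqVneq d 0.
  by apply: stab_eq (stab_id i) => f; rewrite shift_s0.
(* With [2 c q = - d] both products shift by [d]; their multipliers [(t - c q alpha)^2] and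
   [t (t - 2 c q alpha)] differ by [(c q alpha)^2], nonzero because [d] is. *)
pose c := - (d / (2%:R * q)).
have cq : c * q = - (d / 2%:R).
  by rewrite /c invfM mulrA mulNr mulfVK.
have c0 : (d / 2%:R * alpha i) ^+ 2 != 0.
  by rewrite expf_neq0 // !mulf_neq0 // invr_neq0 // pnatr_eq0.
apply: (stabZK NS c0).
have s1 := stab_comp (stab_famW0 i c) (stab_famW0 i c).
have s2 := stab_comp (stab_tvar i) (stab_famW0 i (c + c)).
apply: stab_eq (stabB NS s1 s2) => f.
have dE : - ((c + c) * q) = d.
  by rewrite mulrDl cq -opprD opprK -splitr.
have dd : d / 2%:R + d / 2%:R = d by rewrite -splitr.
rewrite /famW0 dE [(c + c) * q]mulrDl cq opprK; set a := d / 2%:R.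
have -> : shift_s a ((tvar - (- a * alpha i)%:MP) * shift_s a f)
   = (tvar - (- a * alpha i)%:MP) * shift_s d f.
  rewrite shift_sM (linear_propB _ _ (shift_s_linear a)) shift_s_tvar shift_sC.
  by rewrite shift_sD dd.
rewrite -mul_mpolyC (rmorphXn (@mpolyC 2 K)) /=.
have e1 : (- a * alpha i)%:MP_[2] = - (a * alpha i)%:MP by rewrite mulNr mpolyCN.
rewrite [(- a + - a) * alpha i]mulrDl mpolyCD !e1; ring.
Qed.

Lemma stab_poly_t i p : stab i (fun f => poly_t p * f).
Proof.
elim/poly_ind: p => [|p a IHp].
  apply: stab_eq (stab_zero NS i) => f.
  by rewrite (linear_prop0 poly_t_linear) mul0r.
have s1 := stab_comp IHp (stab_tvar i).
apply: stab_eq (stabD NS s1 (stabZ NS a (stab_id i))) => f.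
by rewrite poly_tMXaddC mulrDl mul_mpolyC mulrA.
Qed.

(** At [c = 0] the family of the [L_{n,0}] is multiplication by [s] plus a polynomial in [t], and
    the latter is already available. *)
Lemma stab_svar i : stab i (fun f => svar * f).
Proof.
have [hc sL] := stab_famL0 i; set P := hc 0 \Po (q^-1 *: 'X).
apply: stab_eq (stabB NS (sL 0) (stabZ NS q (stab_poly_t i P))) => f.
rewrite /famL0 -/P (_ : - (0 * q) = 0); last by rewrite mul0r oppr0.
by rewrite shift_s0 mul0r scale0r subr0 mulrDl -scalerAl addrK.
Qed.

Lemma stab_mul i g : stab i (fun f => g * f).
Proof. exact: (stab_mulmp NS (stab_tvar i) (stab_svar i)). Qed.

Lemma stab_partial_t i : stab i partial_t.
Proof.
have [ai|[qN1 bi]] := hab i; last first.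
  (* The family of the [L_{n,1}] at [c = 1], stripped of its multiplication terms and composed with
     the shift by -1, leaves [b1 i] times the derivative. *)
  have s1 := stab_comp (stab_mul i (poly_t (th i))) (stab_shift_s i 1).
  have s2 := stabD NS (stabZ NS (b2 i) (stab_shift_s i 1)) s1.
  have s3 := stab_comp (stabB NS (stab_famL1 i 1 qN1) s2) (stab_shift_s i (-1)).
  apply: (stabZK NS bi); apply: stab_eq s3 => f.
  by rewrite /famL1 shift_sD subrr shift_s0 !mul1r scale1r addrC addKr.
have [hc sL] := stab_famL0 i.
have sB c : stab i (fun f => (c * q) *: ((tvar - (c * q * alpha i)%:MP) * partial_t f)).
  set P := svar + q *: poly_t (hc c \Po (q^-1 *: 'X)).
  have s1 := stab_comp (stab_mul i P) (stab_shift_s i (- (c * q))).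
  apply: stab_eq (stab_comp (stabB NS s1 (sL c)) (stab_shift_s i (c * q))) => f.
  by rewrite /famL0 -/P shift_sD addNr shift_s0 opprB addrC subrK.
have a0 : 2%:R * alpha i != 0 by rewrite mulf_neq0 // pnatr_eq0.
apply: (stabZK NS a0).
(* For [c q = 1] and [c q = 2] the operators of [sB] are [(t - alpha) d/dt] and
   [2 (t - 2 alpha) d/dt]; twice the first minus the second is [2 alpha d/dt]. *)
have s1 := stabZ NS 2%:R (sB q^-1); have s2 := sB (2%:R / q).
apply: stab_eq (stabB NS s1 s2) => f.
rewrite mulVf // mulfVK // scale1r mul1r -scalerBr -mulrBl -scalerA.
congr (_ *: _); rewrite -mul_mpolyC mulr_natl mulr2n mpolyCD; congr (_ * _); ring.
Qed.

Hypothesis genU_stab : forall i b, (forall g, stab i (fun f => g * f)) ->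
  (forall c, stab i (shift_s c)) -> stab i partial_t -> stab i (genU i b).
Hypothesis actU_linearl : forall i f, linear (fun z => actU i z f).

(** All of the algebra now preserves [N] slot by slot, so its action on the factor [V] alone can be
    isolated. *)
Lemma stab_actU i z : stab i (actU i z).
Proof.
move: z; apply: block_span => [|b]; last first.
  have sg := genU_stab b (stab_mul i) (stab_shift_s i) (stab_partial_t i).
  by apply: stab_eq sg => f; rewrite actU_gen.
split=> [|a z z' sz sz'].
  apply: stab_eq (stab_zero NS i) => f.
  by rewrite (linear_prop0 (actU_linearl i f)).
by apply: stab_eq (stab_lincomb NS a sz sz') => f; rewrite actU_linearl.
Qed.

Lemma tensor_submodule_trivial : irreducible actV ->
  (forall x, N x -> x = 0) \/ (forall x, N x).
Proof.
move=> [_ Virr]; have [N0|/existsNP[x /not_implyP[Nx x0]]] :=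
  pselect (forall x, N x -> x = 0); [by left | right].
have sd i j : stab i (mderiv j).
  case: j => -[|[|//]] hj.
    have -> : Ordinal hj = ord0 by exact: val_inj.
    exact: stab_partial_t.
  have -> : Ordinal hj = ord_max by exact: val_inj.
  exact/(stab_mderiv_s NS)/stab_shift_s.
have hx : exists2 x, N x & x <> 0 by exists x.
have [w Nw w0] := stable_has_pure1 sd hx.
pose S v := N (tpure [ffun=> 1] v).
have Ssub : submodule actV S.
  split=> [|a u v Su Sv|z v Sv]; rewrite /S.
  - by rewrite (linear_prop0 (tpure_linear _)); exact: subspace0 NS.
  - by rewrite tpure_linear; exact: subspaceP NS _ _ _ Su Sv.
  (* Subtracting the slot terms from the full action leaves [z] acting on [v] alone. *)
  have Nz := submodule_act Nsub z Sv; rewrite tact_slot in Nz.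
  rewrite (slotV_pure _ _ (actVL z)) in Nz.
  set y := \sum_i _ in Nz; rewrite -[tpure _ _](addKr y) addrC.
  apply: (subspaceB NS Nz); apply: (subspace_sum NS) => i _ _.
  by case: (stab_actU i z) => _; exact.
have [S0|ST] := Virr S Ssub; first by case: w0; exact: S0.
apply: (tensor_span NS) => f v.
exact: (stable_pure stab_mul (ST v)).
Qed.

End Sufficiency.
End TensorModule.

(** * Vectors invariant under opposite shifts in two slots *)

Section ShiftInvariants.
Context {K : numFieldType} {m : nat} {V : lmodType K}.
Notation Cts := {mpoly K[2]}.
Notation T := (tensor m Cts V).
Context (act : Block K -> T -> T) (genU : 'I_m -> Bgen -> Cts -> Cts).
Context (genV : Bgen -> V -> V).
Hypotheses (actl : forall x, linear (act^~ x))
           (gUL : forall k b, linear (genU k b)) (gVL : forall b, linear (genV b)).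
Hypothesis act_gen : forall b x,
  act (Bbasis b) x = \sum_(k < m) slot k (genU k b) x + slotV (genV b) x.
Context (i j : 'I_m) (ij : i != j) (kappa delta : Bgen -> K) (S : K -> Cts -> Cts).
Hypotheses (SL : forall c, linear (S c)) (SK : forall c f, S c (S (- c) f) = f).
Hypothesis genU_shift : forall k b c f, k = i \/ k = j ->
  S c (genU k b f) = (c * kappa b) *: S (delta b) (S c f) + genU k b (S c f).
Implicit Types (x : T).

Fact slot_shift2_key :
  {s : K -> T -> T | forall c, s c = fun x => slot i (S c) (slot j (S (- c)) x)}.
Proof. by eexists. Qed.

Definition slot_shift2 : K -> T -> T := sval slot_shift2_key.
Notation D := slot_shift2.

Let DEi c x : D c x = slot i (S c) (slot j (S (- c)) x).
Proof. by rewrite /slot_shift2 (svalP slot_shift2_key). Qed.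

Let DL c : linear (D c).
Proof.
apply: linear_prop_eq (linear_comp (slot_linear i (SL c)) (slot_linear j (SL (- c)))) => x.
by rewrite DEi.
Qed.

Let DE c x : D c x = slot j (S (- c)) (slot i (S c) x).
Proof. by rewrite DEi (slotC _ ij (SL c) (SL (- c))). Qed.

Definition shift_invariant x := forall c, D c x = x.
Notation N := shift_invariant.

(** Applying [S d] in slot [j] to the identity [D d x = x] cancels [S (- d)] there. *)
Let slot_delta d x : N x -> slot i (S d) x = slot j (S d) x.
Proof.
move=> Nx; rewrite -[in RHS](Nx d) DE (slot_comp j _ (SL d) (SL (- d))).
rewrite -[LHS](slot_id j); apply: slot_eq => f.
by rewrite SK.
Qed.

Let slot_shift_gen k b c x : k = i \/ k = j ->
  slot k (S c) (slot k (genU k b) x) =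
  (c * kappa b) *: slot k (S (delta b)) (slot k (S c) x)
  + slot k (genU k b) (slot k (S c) x).
Proof.
move=> kij; rewrite (slot_comp k x (SL c) (gUL k b)).
rewrite (slot_comp k x (SL (delta b)) (SL c)) (slot_comp k x (gUL k b) (SL c)).
rewrite -(slot_lincomb k (c * kappa b) x (linear_comp (SL (delta b)) (SL c))
  (linear_comp (gUL k b) (SL c))).
by apply: slot_eq => f; exact: genU_shift.
Qed.

Let D_slot c k A x : k != i -> k != j -> linear A -> N x ->
  D c (slot k A x) = slot k A x.
Proof.
move=> ki kj AL Nx; rewrite DEi -(slotC _ kj AL (SL _)) -(slotC _ ki AL (SL _)).
by rewrite -DEi Nx.
Qed.

Let D_slot_i b c x : N x -> D c (slot i (genU i b) x)
  = (c * kappa b) *: slot i (S (delta b)) x + slot i (genU i b) x.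
Proof.
move=> Nx; rewrite DEi -(slotC _ ij (gUL i b) (SL _)) slot_shift_gen; last by left.
by rewrite -DEi Nx.
Qed.

Let D_slot_j b c x : N x -> D c (slot j (genU j b) x)
  = (- c * kappa b) *: slot i (S (delta b)) x + slot j (genU j b) x.
Proof.
move=> Nx; rewrite DE (slotC _ ij (SL c) (gUL j b)) slot_shift_gen; last by right.
by rewrite -DE Nx slot_delta.
Qed.

(** Commuting [D c] past a generator produces defects in slots [i] and [j] only. As [kappa] and
    [delta] are common to both slots and the shifts are opposite, these defects are opposite
    multiples of vectors that [slot_delta] identifies, hence cancel. *)
Lemma shift_invariant_submodule : submodule act N.
Proof.
split.
- by move=> c; exact: (linear_prop0 (DL c)).
- by move=> a x y Nx Ny c; rewrite DL Nx Ny.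
move=> z x Nx c; move: z; apply: block_span.
  split; first by rewrite (linear_prop0 (actl x)) (linear_prop0 (DL c)).
  by move=> a z z' zx zx'; rewrite actl DL zx zx'.
move=> b; rewrite act_gen (linear_propD _ _ (DL c)).
have -> : D c (slotV (genV b) x) = slotV (genV b) x.
  rewrite DEi (slot_slotV j x (SL _) (gVL b)) (slot_slotV i _ (SL _) (gVL b)).
  by rewrite -DEi Nx.
refine (congr1 (fun y => y + _) _).
rewrite (linear_prop_sum _ _ _ (DL c)).
have ji : j != i by rewrite eq_sym.
rewrite [LHS](bigD1 i) // [RHS](bigD1 i) // (bigD1 j) // [in RHS](bigD1 j) //=.
rewrite (D_slot_i b c Nx) (D_slot_j b c Nx) mulNr scaleNr.
rewrite [X in _ + (_ + X) = _](eq_bigr (fun k => slot k (genU k b) x))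
  => [|k /andP[ki kj]]; last first.
  exact: D_slot.
by rewrite -(addrA (- _)) addrACA subrr add0r.
Qed.

End ShiftInvariants.

(** * Necessity of the three conditions *)

Section Necessity.
Context {K : numFieldType} {m : nat} {V : lmodType K}.
Notation Cts := {mpoly K[2]}.
Notation T := (tensor m Cts V).
Context (actU : 'I_m -> Block K -> Cts -> Cts) (actV : Block K -> V -> V).
Hypotheses (actUL : forall i z, linear (actU i z)) (actVL : forall z, linear (actV z)).
Notation act := (tensor_act actU actV).
Notation one := ([ffun=> 1] : {ffun 'I_m -> Cts}).
Implicit Types (f : {ffun 'I_m -> Cts}) (v : V) (x : T) (i : 'I_m).

Lemma meval_scalar (a : 'I_2 -> K) : scalar (meval a).
Proof. by move=> c f g; rewrite mevalD mevalZ. Qed.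

(** All variables in all slots are set to the same value [a]; the values 0 and 1 suffice to test
    submodules. *)
Let ev (a : K) : T -> V := tensor_eval (fun _ => meval (fun=> a)).

Let evL a : linear (ev a).
Proof. by apply: tensor_eval_linear => i; exact: meval_scalar. Qed.

Let ev_pure a f v : ev a (tpure f v) = (\prod_i (f i).@[fun=> a]) *: v.
Proof. by apply: tensor_eval_pure => i; exact: meval_scalar. Qed.

Let ev_eq1 a f v : (forall i, (f i).@[fun=> a] = 1) -> ev a (tpure f v) = v.
Proof. by move=> fa; rewrite ev_pure big1 ?scale1r // => i _; rewrite fa. Qed.

Let ev_eq0 a f v i : (f i).@[fun=> a] = 0 -> ev a (tpure f v) = 0.
Proof. by move=> fi; rewrite ev_pure (bigD1 i) //= fi mul0r scale0r. Qed.

Let ev_one a v : ev a (tpure one v) = v.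
Proof. by apply: ev_eq1 => i; rewrite ffunE rmorph1. Qed.

Lemma tpure_one_inj v : tpure one v = 0 -> v = 0.
Proof. by move=> v0; rewrite -(ev_one 0 v) v0 (linear_prop0 (evL 0)). Qed.

Lemma tact_linear z : linear (act z).
Proof. by apply: tensor_act_linear => [i|]. Qed.

Lemma irreducible_nonzero_factor : irreducible act -> exists v : V, v <> 0.
Proof.
move=> [[x x0] _]; apply: contrapT => Vn; case: x0.
have V0 v : v = 0 by apply: contrapT => v0; case: Vn; exists v.
move: x; apply: tensor_ext => [||f v]; [by []|exact: linear_prop_zero|].
by rewrite (V0 v); exact: linear_prop0 (tpure_linear f).
Qed.

(** The span is encoded as the intersection of the subspaces containing the generators: membership
    is exploited by a choice of [M], without decomposing vectors. *)
Definition purespan (P : {ffun 'I_m -> Cts} -> V -> Prop) x :=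
  forall M : T -> Prop, subspace M -> (forall f v, P f v -> M (tpure f v)) -> M x.

Lemma purespan_pure (P : {ffun 'I_m -> Cts} -> V -> Prop) f v :
  P f v -> purespan P (tpure f v).
Proof. by move=> Pfv M _; apply. Qed.

Lemma purespan_submodule (P : {ffun 'I_m -> Cts} -> V -> Prop) :
  (forall z f v i, P f v -> P (upd f i (actU i z (f i))) v) ->
  (forall z f v, P f v -> P f (actV z v)) ->
  submodule act (purespan P).
Proof.
move=> PU PV; split.
- by move=> M MS _; exact: subspace0.
- move=> a x y Px Py M MS MP.
  by apply: (subspaceP MS); [exact: Px | exact: Py].
move=> z x Px M MS MP; apply: (Px (fun y => M (act z y))).
  split; first by rewrite (linear_prop0 (tact_linear z)); exact: subspace0.
  by move=> a y y' My My'; rewrite tact_linear; exact: subspaceP.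
move=> f v Pfv; rewrite tensor_act_pure //.
apply: (subspaceD MS); last exact/MP/PV.
by apply: (subspace_sum MS) => i _ _; exact/MP/PU.
Qed.

Lemma irreducible_last_factor : irreducible act -> irreducible actV.
Proof.
move=> Tirr; split; first exact: irreducible_nonzero_factor.
move=> S [S0 SP Sact]; pose P (f : {ffun 'I_m -> Cts}) v := S v.
have Psub : submodule act (purespan P).
  by apply: purespan_submodule => // z f v; exact: Sact.
have [P0|PT] := (proj2 Tirr) _ Psub; [left|right] => v.
  move=> Sv; rewrite -(ev_one 0 v) (P0 (tpure one v)); first exact: (linear_prop0 (evL 0)).
  exact: purespan_pure.
(* [M] is the preimage of [S] under evaluation at 0, which sends a generator to a multiple of its
   last factor and [one] tensor [v] to [v]. *)
rewrite -(ev_one 0 v); apply: (PT (tpure one v) (fun y => S (ev 0 y))).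
  split=> [|a x y Sx Sy]; first by rewrite (linear_prop0 (evL 0)).
  by rewrite evL; exact: SP.
move=> f w Sw; rewrite ev_pure -[_ *: w]addr0; exact: SP.
Qed.

(** The tensors whose [i]-th factor is divisible by [t] span a submodule. It is nonzero, as
    evaluation at 1 shows, and proper, since evaluation at 0 kills it but not [one] tensor [v]. *)
Lemma reducible_tvar_invariant i :
  (forall z (f : Cts), (exists g, f = tvar * g) -> exists g, actU i z f = tvar * g) ->
  ~ irreducible act.
Proof.
move=> ti Tirr; have [v v0] := irreducible_nonzero_factor Tirr.
pose P (f : {ffun 'I_m -> Cts}) (w : V) := exists g, f i = tvar * g.
have Psub : submodule act (purespan P).
  apply: purespan_submodule => // z f w k Pf; rewrite /P.
  have [->|ki] := eqVneq k i; first by rewrite updE; exact: ti.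
  by rewrite upd_neq.
have [P0|PT] := (proj2 Tirr) _ Psub; case: v0.
  have Pt : P (upd one i tvar) v by exists 1; rewrite updE mulr1.
  have <- : ev 1 (tpure (upd one i tvar) v) = v.
    apply: ev_eq1 => k; rewrite ffunE; case: eqP => _; first by rewrite mevalXU.
    by rewrite ffunE rmorph1.
  by rewrite (P0 _ (purespan_pure Pt)); exact: (linear_prop0 (evL 1)).
rewrite -(ev_one 0 v); apply: (PT (tpure one v) (fun y => ev 0 y = 0)).
  split=> [|a x y x0 y0]; first exact: (linear_prop0 (evL 0)).
  by rewrite (evL 0) x0 y0 scaler0 addr0.
by move=> f w [g fi]; apply: (ev_eq0 _ (i := i)); rewrite fi mevalM mevalXU mul0r.
Qed.

Section EqualLambda.
Context (genU : 'I_m -> Bgen -> Cts -> Cts) (genV : Bgen -> V -> V).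
Hypotheses (actU_gen : forall i b (f : Cts), actU i (Bbasis b) f = genU i b f)
           (actV_gen : forall b v, actV (Bbasis b) v = genV b v)
           (actU_linearl : forall i (f : Cts), linear (fun z => actU i z f))
           (actV_linearl : forall v, linear (actV^~ v)).
Context (i j : 'I_m) (ij : i != j) (kappa delta : Bgen -> K).
Hypothesis genU_shift : forall k b c (f : Cts), k = i \/ k = j ->
  shift_s c (genU k b f)
  = (c * kappa b) *: shift_s (delta b) (shift_s c f) + genU k b (shift_s c f).

Lemma tact_linearl x : linear (fun z => act z x).
Proof.
move=> a z z'; move: x; apply: tensor_ext.
- exact: tact_linear.
- by apply: linear_lincomb; exact: tact_linear.
move=> f v; rewrite !tensor_act_pure // actV_linearl tpure_linear.
rewrite scalerDr addrACA scaler_sumr -big_split /=.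
refine (congr1 (fun y => y + _) _); apply: eq_bigr => k _.
by rewrite actU_linearl tpure_linear_slot.
Qed.

(** The tensor of ones with [v] is invariant under the double shifts. Placing [s] in slot [i] gives
    a vector that is not: the shift turns [s] into [s + 1], and evaluation at 0 tells them apart. *)
Lemma reducible_equal_lambda : ~ irreducible act.
Proof.
move=> Tirr; have [v v0] := irreducible_nonzero_factor Tirr.
have ji : j != i by rewrite eq_sym.
have S1 c : shift_s c (1 : Cts) = 1 by rewrite -mpolyC1 shift_sC.
pose SL := @shift_s_linear K; pose N := shift_invariant (V := V) i j (@shift_s K).
have NE x : N x -> forall c, slot i (shift_s c) (slot j (shift_s (- c)) x) = x.
  by move=> Nx c; rewrite -[RHS](Nx c) /slot_shift2 (svalP (slot_shift2_key _ _ _)).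
have Nsub : submodule act N.
  apply: (@shift_invariant_submodule _ _ _ act genU genV _ _ _ _ i j ij kappa delta) => //.
  - exact: tact_linearl.
  - exact: genU_linear.
  - exact: genV_linear.
  - exact: tact_gen.
  - by move=> c f; rewrite shift_sD subrr shift_s0.
have [N0|NT] := (proj2 Tirr) _ Nsub; case: v0.
  have N1 : N (tpure one v).
    have sl k c : slot k (shift_s c) (tpure one v) = tpure one v.
      rewrite (slot_pure _ _ _ (SL c)) ffunE S1.
      by have -> : upd one k 1 = one by apply/ffunP => l; rewrite !ffunE; case: eqP.
    by move=> c; rewrite /slot_shift2 (svalP (slot_shift2_key _ _ _)) !sl.
  by rewrite -(ev_one 0 v) (N0 _ N1); exact: (linear_prop0 (evL 0)).
have := NE _ (NT (tpure (upd one i svar) v)) 1.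
rewrite (slot_pure _ _ _ (SL _)) (upd_neq _ _ ij) ffunE S1.
have -> : upd (upd one i svar) j 1 = upd one i svar.
  by apply/ffunP => k; rewrite !ffunE; case: (eqVneq k j) => // ->; rewrite (negPf ji).
rewrite (slot_pure _ _ _ (SL _)) upd_upd updE shift_s_svar.
move/(congr1 (ev 0)); rewrite [RHS](ev_eq0 _ (i := i)); last by rewrite updE mevalXU.
rewrite ev_eq1 // => k; rewrite ffunE; case: eqP => _; last by rewrite ffunE rmorph1.
by rewrite mevalD mevalXU mevalC add0r.
Qed.

End EqualLambda.
End Necessity.

(** * The generators on one factor: commutation with shifts, the ideal of [t], stability *)

Section OmegaGenerators.
Context {K : numFieldType} (q lambda alpha : K) (beta gamma : K * K).
Context (h : int -> {poly K}).
Notation Cts := {mpoly K[2]}.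
Implicit Types (f g : Cts) (b : Bgen).

Let gen := Omega_gen q lambda alpha beta gamma h.

(** Together with [shift_step] this records the defect of commutation with shifts; besides [q], it
    depends on the factor only through [lambda]. *)
Definition shift_coef b : K := if b is BL n 0 then lambda ^ n else 0.
Definition shift_step b : K := if b is BL n _ then - (n%:~R * q) else 0.

Let Sadd c f g := linear_propD f g (shift_s_linear c).
Let Sscale c a f := linear_propZ a f (shift_s_linear c).
Let Szero c := linear_prop0 (@shift_s_linear K c).

Lemma shift_sC_comm c d f : shift_s c (shift_s d f) = shift_s d (shift_s c f).
Proof. by rewrite !shift_sD addrC. Qed.

(* Only the summand s f of L_{n,0} does not commute with shifts of s. *)
Lemma Omega_gen_shift b c f : shift_s c (gen b f)
  = (c * shift_coef b) *: shift_s (shift_step b) (shift_s c f) + gen b (shift_s c f).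
Proof.
have ifS (e : bool) g : shift_s c (if e then g else 0) = if e then shift_s c g else 0.
  by case: e => //; exact: Szero.
have SX d g : shift_s c (shift_s d g) = shift_s d (shift_s c g) by exact: shift_sC_comm.
case: b => [n i|n i||] /=; last 2 first.
- by rewrite mulr0 scale0r Szero addr0.
- by rewrite mulr0 scale0r Szero addr0.
- rewrite /OmegaL !Sadd !ifS !Sscale.
  have -> : shift_s c (beta.2 *: shift_s n%:~R f
      + n%:~R *: (poly_t (Theta alpha h beta.1) * shift_s n%:~R f)
      + (n%:~R * beta.1) *: partial_t (shift_s n%:~R f))
    = beta.2 *: shift_s n%:~R (shift_s c f)
      + n%:~R *: (poly_t (Theta alpha h beta.1) * shift_s n%:~R (shift_s c f))
      + (n%:~R * beta.1) *: partial_t (shift_s n%:~R (shift_s c f)).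
    by rewrite !Sadd !Sscale shift_sM shift_s_poly_t shift_s_partial_t !SX.
  have addE (A A' B C D : Cts) : A' = D + A -> A' + B + C = D + (A + B + C).
    by move=> ->; rewrite -!addrA.
  apply: addE.
  case: i => [|i] /=; last by rewrite mulr0 scale0r addr0.
  rewrite (linear_propB _ _ (shift_s_linear c)) !Sscale !shift_sM.
  rewrite Sadd Sscale shift_s_svar shift_s_poly_t !SX shift_s_partial_t SX.
  rewrite (linear_propB _ _ (shift_s_linear c)) shift_s_tvar shift_sC addrA.
  refine (congr1 (fun y => y - _) _).
  set A := q *: _; set B := shift_s _ _.
  have -> : (svar + c%:MP + A) * B = c *: B + (svar + A) * B.
    by rewrite -mul_mpolyC; ring.
  by rewrite scalerDr scalerA mulrC.
rewrite /OmegaW mulr0 scale0r add0r !Sadd !ifS !Sscale shift_sM !SX.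
by rewrite (linear_propB _ _ (shift_s_linear c)) shift_s_tvar shift_sC.
Qed.

(** Only differentiation in [t] can leave the ideal of [t]. For [alpha = 0] it occurs in [L_{n,0}]
    multiplied by [t], and for [beta.1 = 0] its occurrence in [L_{n,1}] vanishes. *)
Lemma Omega_gen_tvar b f : alpha = 0 -> beta.1 = 0 ->
  (exists g, f = tvar * g) -> exists g, gen b f = tvar * g.
Proof.
move=> a0 b0 [g ->]; pose P f := exists g, f = tvar * g.
have PS : subspace P.
  split; first by exists 0; rewrite mulr0.
  move=> a f' f'' [g' ->] [g'' ->]; exists (a *: g' + g'').
  by rewrite mulrDr scalerAr.
have PM f' f'' : P f'' -> P (f' * f'') by move=> [g' ->]; exists (f' * g'); rewrite mulrCA.
have PM' f' f'' : P f' -> P (f' * f'') by move=> [g' ->]; exists (g' * f''); rewrite mulrA.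
have Psh c : P (shift_s c (tvar * g)).
  by exists (shift_s c g); rewrite shift_sM shift_s_tvar.
have Pt (n : int) : P (tvar - (n%:~R * q * alpha)%:MP).
  by exists 1; rewrite a0 mulr0 mpolyC0 subr0 mulr1.
have Pg : P (tvar * g) by exists g.
have ifP (e : bool) f' : P f' -> P (if e then f' else 0).
  by case: e => // _; exact: subspace0.
change (P (gen b (tvar * g))); case: b => [n i|n i||]; try exact: subspace0 PS.
- apply: (subspaceD PS); first apply: (subspaceD PS); apply: ifP.
  + apply: (subspaceB PS); apply: (subspaceZ PS); first exact: PM.
    exact: PM'.
  + exact: (subspaceZ PS).
  + apply: (subspaceZ PS); rewrite b0 mulr0 scale0r addr0.
    by apply: (subspaceD PS); apply: (subspaceZ PS) => //; exact: PM.
- apply: (subspaceD PS); first apply: (subspaceD PS); apply: ifP.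
  + by apply: (subspaceZ PS); exact: PM'.
  + exact: (subspaceZ PS).
  + by rewrite b0 mul0r scale0r; exact: subspace0.
Qed.

Lemma Omega_act_tvar z f : alpha = 0 -> beta.1 = 0 ->
  (exists g, f = tvar * g) ->
  exists g, Omega_act q lambda alpha beta gamma h z f = tvar * g.
Proof.
move=> a0 b0 tf; move: z; apply: block_span => [|b]; last first.
  by rewrite Omega_act_basis; exact: Omega_gen_tvar.
have aL := Omega_act_linearl q lambda alpha beta gamma h f.
split=> [|a z z' [g gE] [g' gE']].
  by exists 0; rewrite (linear_prop0 aL) mulr0.
by exists (a *: g + g'); rewrite aL gE gE' mulrDr scalerAr.
Qed.

Lemma stab_Omega_gen (m : nat) (V : lmodType K) (N : tensor m Cts V -> Prop)
    (i : 'I_m) b : subspace N ->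
  (forall g, stab (N := N) i (fun f => g * f)) ->
  (forall c, stab (N := N) i (shift_s c)) -> stab (N := N) i partial_t ->
  stab (N := N) i (gen b).
Proof.
move=> NS sM sS sP.
have sif (e : bool) (A : Cts -> Cts) :
    stab (N := N) i A -> stab (N := N) i (fun f => if e then A f else 0).
  by case: e => // _; exact: stab_zero.
have sPS c := stab_comp sP (sS c).
case: b => [n j|n j||]; try exact: stab_zero.
- apply: (stabD NS); first apply: (stabD NS); apply: sif.
  + apply: (stabB NS); apply: (stabZ NS); last exact: (stab_comp (sM _) (sPS _)).
    exact: (stab_comp (sM _) (sS _)).
  + exact: (stabZ NS _ (stab_id i)).
  + apply: (stabZ NS); apply: (stabD NS); last exact: (stabZ NS _ (sPS _)).
    apply: (stabD NS); first exact: (stabZ NS _ (sS _)).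
    exact: (stabZ NS _ (stab_comp (sM _) (sS _))).
- apply: (stabD NS); first apply: (stabD NS); apply: sif.
  + exact: (stabZ NS _ (stab_comp (sM _) (sS _))).
  + exact: (stabZ NS _ (stab_id i)).
  + exact: (stabZ NS _ (sS _)).
Qed.

End OmegaGenerators.

(** * The irreducibility criterion, assembled from both directions *)

Theorem theorem4p7 (R : realType) (q : R[i]) (hq : q != 0)
    (m : nat) (hm : (0 < m)%N)
    (lambda alpha : 'I_m -> R[i]) (beta gamma : 'I_m -> R[i] * R[i])
    (h : 'I_m -> int -> {poly R[i]})
    (hlambda : forall i : 'I_m, lambda i != 0)
    (hh : forall i : 'I_m, inT (alpha i) (h i))
    (hbeta : forall i : 'I_m, q != -1 -> beta i = (0, 0))
    (hgamma : forall i : 'I_m,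
       ~ (exists n : nat, - (2%:R * q) = n%:R) -> gamma i = (0, 0))
    (V : lmodType R[i]) (actV : Block R[i] -> V -> V)
    (hV : lie_module (Bbracket q) actV) (hVres : restricted actV) :
  irreducible
    (tensor_act
       (fun i : 'I_m =>
          Omega_act q (lambda i) (alpha i) (beta i) (gamma i) (h i))
       actV)
  <->
  [/\ (forall i j : 'I_m, i <> j -> lambda i <> lambda j),
      irreducible actV &
      forall i : 'I_m,
        alpha i != 0 \/ (q = -1 /\ (beta i).1 != 0)].
Proof.
have OmL i z := Omega_act_linear q (lambda i) (alpha i) (beta i) (gamma i) (h i) z.
have OmLl i f := Omega_act_linearl q (lambda i) (alpha i) (beta i) (gamma i) (h i) f.
pose gU i := Omega_gen q (lambda i) (alpha i) (beta i) (gamma i) (h i).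
pose gV b := actV (Bbasis b).
have VL := lie_act_linearr hV.
have VLl : forall v, linear (actV^~ v) by exact: lie_act_linearl hV.
have gUE i b f : Omega_act q (lambda i) (alpha i) (beta i) (gamma i) (h i) (Bbasis b) f
  = gU i b f by exact: Omega_act_basis.
have gVE b v : actV (Bbasis b) v = gV b v by [].
split=> [Tirr|[lam_inj Virr hab]]; first split.
- move=> i j ij lij; have ij' : i != j by apply/eqP.
  (* Equality of the two [lambda] makes the defect common to slots [i] and [j]. *)
  have sh k b c f : k = i \/ k = j -> shift_s c (gU k b f)
      = (c * shift_coef (lambda i) b) *: shift_s (shift_step q b) (shift_s c f)
        + gU k b (shift_s c f).
    have E l := Omega_gen_shift q (lambda l) (alpha l) (beta l) (gamma l) (h l) b c f.
    move=> [->|->]; [exact (E i) | rewrite lij; exact (E j)].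
  exact: (reducible_equal_lambda OmL VL gUE gVE OmLl VLl ij' sh Tirr).
- exact: (irreducible_last_factor OmL VL Tirr).
- move=> i; have [a0|] := eqVneq (alpha i) 0; [right | by left].
  have [b0|b0] := eqVneq (beta i).1 0.
    exfalso; apply: (reducible_tvar_invariant OmL VL (i := i) _ Tirr) => z f.
    exact: Omega_act_tvar.
  (* By [hbeta], a nonzero first component of [beta i] forces [q = -1]. *)
  split=> //; apply/eqP; apply: contraNT b0 => /hbeta ->.
  by rewrite eqxx.
split.
  have [v v0] := proj1 Virr; exists (tpure [ffun=> 1] v) => v1.
  exact/v0/(tpure_one_inj v1).
move=> N Nsub.
have linj : injective lambda.
  by move=> i j; apply: contraPP => /lam_inj.
have genL0 i : exists hc, polyfam hc /\ forall (n : nat) f, (0 < n)%N ->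
    gU i (BL n 0) f = lambda i ^+ n *: famL0 q (alpha i) hc n%:R f.
  have [hc ph hE] := inT_polyfam (hh i); exists hc; split=> // n f n0.
  exact: OmegaL0_fam.
have genW1 i n f (n0 : (0 < n)%N) (qE : q = -1) :=
  OmegaW1_fam (lambda i) (alpha i) (beta i) (gamma i) n0 f qE.
have genL1 i n f (n0 : (0 < n)%N) (qE : q = -1) :=
  OmegaL1_fam (lambda i) (alpha i) (beta i) (gamma i) (h i) n0 f qE.
have genW0 i n f (n0 : (0 < n)%N) :=
  OmegaW0_fam q (lambda i) (alpha i) (beta i) (gamma i) n0 f.
have genV0 v : exists n0, forall n : nat, (n0 < n)%N -> forall j : nat,
    gV (BL n j) v = 0 /\ gV (BW n j) v = 0.
  by have [n0 Hn] := hVres v; exists n0 => n hn j; exact: Hn.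
have NS := submodule_subspace Nsub.
have gUs i b := @stab_Omega_gen _ q (lambda i) (alpha i) (beta i) (gamma i) (h i)
  _ _ N i b NS.
exact: (tensor_submodule_trivial OmL VL gUE gVE hq hlambda linj genW0 genL0 genW1
  genL1 genV0 hab Nsub gUs OmLl Virr).
Qed.
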